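(* Let $R$ be a commutative ring, $n\ge2$, $t\ge1$, and let $\varphi$ be a $2n\times2n$ alternating matrix over $R$ with Pfaffian $1$. Let $\theta(X_1,\dots,X_t)\in{\rm SL}_{2n-1}(R[X_1,\dots,X_t])$ with $\theta(0,\dots,0)=I_{2n-1}$. If for every maximal ideal $\mathfrak m$ of $R$ the image of $\theta$ over $R_{\mathfrak m}[X_1,\dots,X_t]$ lies in ${\rm E}_{\varphi\otimes R_{\mathfrak m}[X_1,\dots,X_t]}(R_{\mathfrak m}[X_1,\dots,X_t])$, then $\theta(X_1,\dots,X_t)\in{\rm E}_{\varphi\otimes R[X_1,\dots,X_t]}(R[X_1,\dots,X_t])$.
   Context: All rings are commutative with identity; $R_{\mathfrak m}$ is the localisation at $\mathfrak m$. A square matrix is alternating if it is of the form $\nu-\nu^t$; alternating matrices of Pfaffian $1$ are invertible. Elements of $S^m$ are row vectors, ${}^t$ is transpose. For an invertible alternating $2n\times2n$ matrix $\varphi$ over a ring $S$ write $\varphi=\begin{pmatrix}0&-c\\ c^t&\nu\end{pmatrix}$, $\varphi^{-1}=\begin{pmatrix}0&d\\ -d^t&\mu\end{pmatrix}$ with $c,d\in S^{2n-1}$, and set $\alpha_\varphi(v)=I_{2n-1}+d^tv\nu$, $\beta_\varphi(v)=I_{2n-1}+\mu v^tc$ for $v\in S^{2n-1}$; ${\rm E}_\varphi(S)$ is the subgroup of ${\rm GL}_{2n-1}(S)$ generated by all these. For a ring homomorphism $R\to S$, ${\rm E}_{\varphi\otimes S}(S)$ denotes ${\rm E}_{\varphi'}(S)$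 where $\varphi'$ is the image of $\varphi$ over $S$. *)

(* Defs.v *)
From HB Require Import structures.
From mathcomp Require Import all_boot all_order all_fingroup all_algebra.
From Stdlib Require Import ClassicalEpsilon.

Set Implicit Arguments.
Unset Strict Implicit.
Unset Printing Implicit Defensive.

Import GRing.Theory.
Local Open Scope ring_scope.

Fixpoint mpoly (R : comNzRingType) (t : nat) : comNzRingType :=
  match t with
  | 0 => R
  | t'.+1 => ({poly mpoly R t'} : comNzRingType)
  end.

Fixpoint mconst (R : comNzRingType) (t : nat) : R -> mpoly R t :=
  match t return R -> mpoly R t with
  | 0 => id
  | t'.+1 => fun r => (@mconst R t' r)%:P
  end.

Fixpoint mmap (R S : comNzRingType) (f : R -> S) (t : nat) : mpoly R t -> mpoly S t :=
  match t return mpoly R t -> mpoly S t with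
  | 0 => f
  | t'.+1 => fun p => map_poly (@mmap R S f t') p
  end.

Fixpoint meval0 (R : comNzRingType) (t : nat) : mpoly R t -> R :=
  match t return mpoly R t -> R with
  | 0 => id
  | t'.+1 => fun p => @meval0 R t' p.[0]
  end.

Definition alternating (R : comNzRingType) (m : nat) (A : 'M[R]_m) : Prop :=
  exists N : 'M[R]_m, A = N - N^T.

(* Permutations s of {0..k} (k+1 = 2n) with s(2i) < s(2i+1) and
   s(0) < s(2) < ... ; these enumerate the perfect matchings once each. *)
Definition pf_canon (k : nat) (s : 'S_(1 + k)) : bool :=
  [forall i : 'I_((1 + k)./2), (nat_of_ord (s (inord i.*2)) < s (inord i.*2.+1))%N] &&
  [forall i : 'I_((1 + k)./2), forall j : 'I_((1 + k)./2),
      ((i < j)%N ==> (nat_of_ord (s (inord i.*2)) < s (inord j.*2))%N)].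

Definition pfaffian (R : comNzRingType) (k : nat) (A : 'M[R]_(1 + k)) : R :=
  \sum_(s : 'S_(1 + k) | pf_canon s)
     (-1) ^+ s * \prod_(i < (1 + k)./2) A (s (inord i.*2)) (s (inord i.*2.+1)).

(* phi^{-1}: the (unique, when phi is invertible) matrix psi with psi phi = 1 *)
Definition minv (S : comNzRingType) (m : nat) (phi : 'M[S]_m) : 'M[S]_m :=
  epsilon (inhabits 0) (fun psi : 'M[S]_m => psi *m phi = 1%:M).

Section Egroup.
Variables (S : comNzRingType) (k : nat) (phi : 'M[S]_(1 + k)).

(* phi = [[0, -c], [c^t, nu]],  phi^{-1} = [[0, d], [-d^t, mu]] *)
Definition phi_c : 'rV[S]_k := - ursubmx phi.
Definition phi_nu : 'M[S]_k := drsubmx phi.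
Definition phi_d : 'rV[S]_k := ursubmx (minv phi).
Definition phi_mu : 'M[S]_k := drsubmx (minv phi).

Definition alpha_phi (v : 'rV[S]_k) : 'M[S]_k := 1%:M + phi_d^T *m v *m phi_nu.
Definition beta_phi (v : 'rV[S]_k) : 'M[S]_k := 1%:M + phi_mu *m v^T *m phi_c.

Inductive in_Ephi : 'M[S]_k -> Prop :=
| in_Ephi1 : in_Ephi 1%:M
| in_Ephi_alpha v : in_Ephi (alpha_phi v)
| in_Ephi_beta v : in_Ephi (beta_phi v)
| in_Ephi_mul g h : in_Ephi g -> in_Ephi h -> in_Ephi (g *m h)
| in_Ephi_inv g h : in_Ephi g -> g *m h = 1%:M -> h *m g = 1%:M -> in_Ephi h.
End Egroup.

Definition ideal (R : comNzRingType) (I : R -> Prop) : Prop :=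
  [/\ I 0, (forall a b, I a -> I b -> I (a + b)) & (forall r a, I a -> I (r * a))].

Definition maximal_ideal (R : comNzRingType) (m : R -> Prop) : Prop :=
  [/\ ideal m, ~ m 1 &
      forall J : R -> Prop, ideal J -> (forall a, m a -> J a) ->
        (forall a, J a <-> m a) \/ J 1].

(* iota : R -> S is (isomorphic to) the localisation R -> R_m at R \ m
   (standard characterisation, Atiyah-Macdonald Cor. 3.2). *)
Definition is_localization (R S : comNzRingType) (m : R -> Prop) (iota : R -> S) : Prop :=
  [/\ forall s, ~ m s -> exists u, iota s * u = 1,
      forall x : S, exists a s, ~ m s /\ x * iota s = iota a &
      forall a, iota a = 0 -> exists s, ~ m s /\ s * a = 0].

(* Main.v *)
(** Writing [phi = [[0, -c], [c^t, nu]]] and [phi^-1 = [[0, d], [-d^t, mu]]], the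
    relations [c d^t = 1], [c mu = 0], [nu d^t = 0], [d^t c + mu nu = 1] show that
    the generators of E_phi are exactly the transvections [1 + d^t w] with
    [w d^t = 0] and [1 + u c] with [c u = 0]; so the group depends only on the
    unimodular pair [(c, d)].  Locally [(c, d)] is equivalent to [(e_i, e_i)], and
    since the size is at least 3, Suslin's trick writes every [1 + x y] with
    [y x = 0] and [x] or [y] unimodular through elementary transvections, in such
    a way that multiplying [x y] by a suitable denominator makes the whole product
    lift to the original ring.  This gives the dilation principle: if [eta(0) = 1]
    and [eta(Z)] is locally elementary then [eta(sZ)] is elementary for some [s]
    outside the maximal ideal.  Applied to [theta((Y + Z) X) theta(Y X)^-1], it
    shows that Quillen's ideal of those [s] for which
    [theta((Y + s Z) X) theta(Y X)^-1] is elementary lies in no maximal ideal;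
    then [s = 1], [Y = 0], [Z = 1] gives [theta].  The Pfaffian only enters to make
    [phi] invertible: [Pf] is linear in each row and vanishes on equal rows. *)

Require Import Defs.
From HB Require Import structures.
From mathcomp Require Import all_boot all_order all_fingroup all_algebra zify ring.
From mathcomp Require Import generic_quotient.
From mathcomp Require classical_sets.
From Stdlib Require Import ClassicalEpsilon.
Import GRing.Theory.
Local Open Scope ring_scope.

Set Implicit Arguments.
Unset Strict Implicit.
Unset Printing Implicit Defensive.

(** * Rank one nilpotents and Suslin's trick *)

Section UnimodularRankOne.
Variables (K : comNzRingType) (m : nat).
Implicit Types (P : 'M[K]_m -> Prop) (N : 'M[K]_m) (x : 'cV[K]_m) (y : 'rV[K]_m).

(** Abstracts the matrices [N] all of whose multiples give a reachable [1 + a N]: [tclD] reflects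
    [(1 + N1)(1 + N2) = 1 + N1 + N2], and [tclM] the commutator of [1 + N1] and [1 + N2]. *)
Record transvection_closed P : Prop := TransvectionClosed {
  tcl0 : P 0;
  tclZ : forall a N, P N -> P (a *: N);
  tclD : forall N1 N2, P N1 -> P N2 -> N1 *m N2 = 0 -> P (N1 + N2);
  tclM : forall N1 N2, P N1 -> P N2 -> N2 *m N1 = 0 ->
    N1 *m N1 = 0 -> N2 *m N2 = 0 -> P (N1 *m N2);
  tcl_delta : forall i j, i != j -> P (delta_mx i j) }.

(** Transposition reduces the case of a unimodular row to that of a unimodular column. *)
Lemma transvection_closed_tr P :
  transvection_closed P -> transvection_closed (fun N => P N^T).
Proof.
case=> P0 PZ PD PM Pd; split.
- by rewrite trmx0.
- by move=> a N; rewrite linearZ; apply: PZ.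
- move=> N1 N2 p1 p2 e; rewrite linearD addrC; apply: PD => //.
  by rewrite -trmx_mul e trmx0.
- move=> N1 N2 p1 p2 e e1 e2; rewrite trmx_mul.
  by apply: PM => //; rewrite -trmx_mul ?e ?e1 ?e2 trmx0.
- by move=> i j ij; rewrite trmx_delta; apply: Pd; rewrite eq_sym.
Qed.

(** This is where size at least 3 enters. *)
Lemma third_index (i j : 'I_m) : (2 < m)%N -> exists k, (k != i) && (k != j).
Proof.
move=> m3; suff /card_gt0P [k] : (0 < #|[set~ i] :\ j|)%N.
  by rewrite !inE andbC; exists k.
have := cardsD1 j [set~ i]; rewrite cardsC1 card_ord => h.
rewrite lt0n; apply/eqP => h0; move: h; rewrite h0 addn0 => h.
have : (m.-1 <= 1)%N by rewrite h leq_b1.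
by rewrite -ltnS -subn1 ltn_subLR ?(ltn_trans _ m3) // ltnNge m3.
Qed.

Variable P : 'M[K]_m -> Prop.
Hypothesis clP : transvection_closed P.
Hypothesis m3 : (2 < m)%N.

(** The Koszul row on coordinates [i], [j]: it is orthogonal to [x]. *)
Let z x i j : 'rV[K]_m := x j 0 *: delta_mx 0 i - x i 0 *: delta_mx 0 j.

Let zx x i j : z x i j *m x = 0.
Proof.
apply/matrixP => a b; rewrite mulmxBl -!scalemxAl -!rowE !mxE !ord1.
by rewrite mulrC subrr.
Qed.

Let tcl_sum (I : finType) (Q : pred I) (g : I -> 'cV[K]_m) (w : 'rV[K]_m) :
  (forall l, Q l -> w *m g l = 0) -> (forall l, Q l -> P (g l *m w)) ->
  P ((\sum_(l | Q l) g l) *m w).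
Proof.
move=> wg Pg.
(* Orthogonality of [w] to the partial sums is carried along, because [tclD] asks for a zero
   product. *)
suff [] : w *m (\sum_(l | Q l) g l) = 0 /\ P ((\sum_(l | Q l) g l) *m w) by [].
apply: (big_ind (fun u => w *m u = 0 /\ P (u *m w))).
- by rewrite mulmx0 mul0mx; split=> //; apply: tcl0 clP.
- move=> u v [wu Pu] [wv Pv]; split; first by rewrite mulmxDr wu wv addr0.
  rewrite mulmxDl; apply: tclD => //.
  by rewrite mulmxA -(mulmxA u) wv mulmx0 mul0mx.
- by move=> l Ql; split; [apply: wg | apply: Pg].
Qed.

Let z_delta x i j l : l != i -> l != j -> z x i j *m delta_mx l 0 = 0 :> 'M_1.
Proof.
move=> li lj; rewrite mulmxBl -!scalemxAl !mul_delta_mx_0 1?eq_sym //.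
by rewrite !scaler0 subrr.
Qed.

Let P_delta_z x i j l : i != j -> l != i -> l != j ->
  P (delta_mx l 0 *m z x i j).
Proof.
move=> ij li lj; rewrite mulmxBr -!scalemxAr !mul_delta_mx -scaleNr.
apply: tclD => //.
- by apply: tclZ => //; apply: tcl_delta.
- by apply: tclZ => //; apply: tcl_delta.
- by rewrite -scalemxAl -scalemxAr mul_delta_mx_0 1?eq_sym // !scaler0.
Qed.

Let P_xz x i j : i != j -> P (x *m z x i j).
Proof.
move=> ij; have [k /andP [ki kj]] := third_index i j m3.
(* [x2] is the part of [x] on coordinates [i], [j]. The rest of [x] times [z x i j] involves only
   off-diagonal matrix units; [x2 *m z x i j] may have diagonal entries, so it is factored through
   the basis vector [k] and handled by [tclM]. *)
pose x2 : 'cV[K]_m := x i 0 *: delta_mx i 0 + x j 0 *: delta_mx j 0.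
have xE : x = \sum_(l | (l != i) && (l != j)) x l 0 *: delta_mx l 0 + x2.
  rewrite {1}[x]matrix_sum_delta.
  under eq_bigr => l _ do rewrite big_ord1.
  by rewrite (bigD1 i) // (bigD1 j) 1?eq_sym //= addrA addrC.
have zx2 : z x i j *m x2 = 0.
  rewrite mulmxDr -!scalemxAr !mulmxBl -!scalemxAl !mul_delta_mx.
  rewrite mul_delta_mx_0 1?eq_sym // mul_delta_mx_0 // !scaler0 subr0 sub0r.
  by rewrite scalerN !scalerA mulrC subrr.
rewrite {1}xE mulmxDl; apply: tclD => //.
- apply: tcl_sum => l /andP [li lj].
    by rewrite -scalemxAr z_delta // scaler0.
  by rewrite -scalemxAl; apply: tclZ => //; apply: P_delta_z.
- have -> : x2 *m z x i j = (x2 *m delta_mx 0 k) *m (delta_mx k 0 *m z x i j).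
    by rewrite mulmxA -(mulmxA x2) mul_delta_mx (_ : delta_mx _ _ = 1%:M) ?mulmx1 //;
       apply/matrixP => a b; rewrite !mxE !ord1.
  apply: tclM => //.
  + rewrite mulmxDl -!scalemxAl !mul_delta_mx; apply: tclD => //.
    * by apply: tclZ => //; apply: tcl_delta => //; rewrite eq_sym.
    * by apply: tclZ => //; apply: tcl_delta => //; rewrite eq_sym.
    * by rewrite -scalemxAl -scalemxAr mul_delta_mx_0 // !scaler0.
  + exact: P_delta_z.
  + by rewrite mulmxA -(mulmxA _ _ x2) zx2 mulmx0 mul0mx.
  + rewrite mulmxA -(mulmxA _ _ x2) mulmxDr -!scalemxAr.
    by rewrite !mul_delta_mx_0 // !scaler0 addr0 mulmx0 mul0mx.
  + by rewrite mulmxA -(mulmxA _ (z _ _ _)) z_delta // mulmx0 mul0mx.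
- by rewrite mulmxA -(mulmxA _ _ x2) zx2 mulmx0 mul0mx.
Qed.

(* Suslin's trick: if [p x = 1] and [y x = 0] then
   [y = \sum_(i, j) y_i p_j (x_j e_i - x_i e_j)], and each
   [x (x_j e_i - x_i e_j)] is reached using a third index. *)
Lemma tcl_unimodular_col x y (p : 'rV[K]_m) :
  y *m x = 0 -> p *m x = 1%:M -> P (x *m y).
Proof.
move=> yx px.
have yE : y = \sum_(ij : 'I_m * 'I_m) (y 0 ij.1 * p 0 ij.2) *: z x ij.1 ij.2.
  rewrite -(pair_bigA _ (fun i j => (y 0 i * p 0 j) *: z x i j)) /=.
  under eq_bigr => i _ do (under eq_bigr => j _ do rewrite scalerBr !scalerA; rewrite big_split).
  rewrite big_split /=.
  have e1 : \sum_i p 0 i * x i 0 = 1.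
    by have := congr1 (fun A : 'M_1 => A 0 0) px; rewrite !mxE.
  have e0 : \sum_i y 0 i * x i 0 = 0.
    by have := congr1 (fun A : 'M_1 => A 0 0) yx; rewrite !mxE.
  have -> : \sum_i \sum_j (y 0 i * p 0 j * x j 0) *: delta_mx 0 i = y.
    rewrite {2}[y]row_sum_delta; apply: eq_bigr => i _.
    rewrite -scaler_suml; congr (_ *: _).
    by under eq_bigr => j _ do rewrite -mulrA; rewrite -mulr_sumr e1 mulr1.
  rewrite exchange_big /= big1 ?addr0 // => j _.
  rewrite sumrN -scaler_suml; under eq_bigr => i _ do rewrite mulrAC.
  by rewrite -mulr_suml e0 mul0r scale0r oppr0.
rewrite yE.
suff [] : (\sum_(ij : 'I_m * 'I_m) (y 0 ij.1 * p 0 ij.2) *: z x ij.1 ij.2) *m x = 0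
  /\ P (x *m \sum_(ij : 'I_m * 'I_m) (y 0 ij.1 * p 0 ij.2) *: z x ij.1 ij.2) by [].
apply: (big_ind (fun w => w *m x = 0 /\ P (x *m w))).
- by rewrite mulmx0 mul0mx; split=> //; apply: tcl0 clP.
- move=> u v [ux Pu] [vx Pv]; split; first by rewrite mulmxDl ux vx addr0.
  by rewrite mulmxDr; apply: tclD => //; rewrite mulmxA -(mulmxA x) ux mulmx0 mul0mx.
- move=> [i j] _ /=; split; first by rewrite -scalemxAl zx scaler0.
  rewrite -scalemxAr; apply: tclZ => //; have [<-|ij] := eqVneq i j.
    by rewrite /z subrr mulmx0; apply: tcl0 clP.
  exact: P_xz.
Qed.

End UnimodularRankOne.

(** The two alternatives match the two kinds of generators: in [d *m w] the column is unimodular, in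
    [u *m c] the row is. *)
Definition unimodular_nilp (K : comNzRingType) (m : nat) (N : 'M[K]_m) : Prop :=
  exists x : 'cV[K]_m, exists y : 'rV[K]_m, [/\ N = x *m y, y *m x = 0 &
   (exists p : 'rV_m, p *m x = 1%:M) \/ (exists q : 'cV_m, y *m q = 1%:M)].

Lemma tcl_unimodular_nilp (K : comNzRingType) (m : nat) (P : 'M[K]_m -> Prop) N :
  transvection_closed P -> (2 < m)%N -> unimodular_nilp N -> P N.
Proof.
move=> clP m3 [x [y [-> yx]]] [[p px]|[q yq]].
  exact: (tcl_unimodular_col clP m3 yx px).
rewrite -[x *m y]trmxK trmx_mul.
apply: (tcl_unimodular_col (transvection_closed_tr clP) m3 (p := q^T)).
  by rewrite -trmx_mul yx trmx0.
by rewrite -trmx_mul yq trmx1.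
Qed.

Lemma unimodular_nilp_conj (K : comNzRingType) (m : nat) (g h N : 'M[K]_m) :
  h *m g = 1%:M -> unimodular_nilp N -> unimodular_nilp (g *m N *m h).
Proof.
move=> hg [x [y [-> yx u]]]; exists (g *m x), (y *m h); split.
- by rewrite !mulmxA.
- by rewrite mulmxA -(mulmxA y) hg mulmx1.
- case: u => [[p px]|[q yq]]; [left; exists (p *m h) | right; exists (g *m q)].
    by rewrite mulmxA -(mulmxA p) hg mulmx1.
  by rewrite mulmxA -(mulmxA y) hg mulmx1.
Qed.

(** * The elementary group of a unimodular pair *)

Section ElementaryGroup.
Variables (S : comNzRingType) (m : nat) (c : 'rV[S]_m) (d : 'cV[S]_m).

(** Words in the transvections, extended on the left. Inverses need no constructor: the generators
    are [1 + N] with [N] of square zero, so [1 - N] is again a generator. *)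
Inductive elem : 'M[S]_m -> Prop :=
| elem1 : elem 1%:M
| elem_rowM w g : w *m d = 0 -> elem g -> elem ((1%:M + d *m w) *m g)
| elem_colM u g : c *m u = 0 -> elem g -> elem ((1%:M + u *m c) *m g).

Lemma elem_row w : w *m d = 0 -> elem (1%:M + d *m w).
Proof. by move=> wd; rewrite -[1%:M + _]mulmx1; apply: elem_rowM wd elem1. Qed.

Lemma elem_col u : c *m u = 0 -> elem (1%:M + u *m c).
Proof. by move=> cu; rewrite -[1%:M + _]mulmx1; apply: elem_colM cu elem1. Qed.

Lemma elemM g h : elem g -> elem h -> elem (g *m h).
Proof.
move=> Eg Eh; elim: Eg => [|w g' wd _ IH|u g' cu _ IH]; first by rewrite mul1mx.
  by rewrite -mulmxA; apply: elem_rowM.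
by rewrite -mulmxA; apply: elem_colM.
Qed.

Lemma elem_inv_ex g : elem g -> exists2 h, elem h & g *m h = 1%:M.
Proof.
elim=> [|w g' wd _ [h Eh gh]|u g' cu _ [h Eh gh]].
- by exists 1%:M; rewrite ?mulmx1 //; apply: elem1.
- exists (h *m (1%:M - d *m w)).
    by apply: elemM => //; rewrite -mulmxN; apply: elem_row; rewrite mulNmx wd oppr0.
  rewrite mulmxA -(mulmxA _ g') gh mulmx1 mulmxDl mul1mx mulmxBr mulmx1 mulmxA.
  by rewrite -(mulmxA d) wd mulmx0 mul0mx subr0 subrK.
- exists (h *m (1%:M - u *m c)).
    by apply: elemM => //; rewrite -mulNmx; apply: elem_col; rewrite mulmxN cu oppr0.
  rewrite mulmxA -(mulmxA _ g') gh mulmx1 mulmxDl mul1mx mulmxBr mulmx1 mulmxA.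
  by rewrite -(mulmxA u) cu mulmx0 mul0mx subr0 subrK.
Qed.

Lemma elem_inv g h : elem g -> g *m h = 1%:M -> elem h.
Proof.
move=> Eg gh; have [k Ek gk] := elem_inv_ex Eg.
by rewrite -[h]mulmx1 -gk mulmxA (mulmx1C gh) mul1mx.
Qed.

End ElementaryGroup.

Lemma elem_map (S S' : comNzRingType) (f : {rmorphism S -> S'}) m
    (c : 'rV[S]_m) (d : 'cV[S]_m) g :
  elem c d g -> elem (map_mx f c) (map_mx f d) (map_mx f g).
Proof.
elim=> [|w g' wd _ IH|u g' cu _ IH]; first by rewrite map_mx1; apply: elem1.
  rewrite map_mxM map_mxD map_mx1 map_mxM; apply: elem_rowM => //.
  by rewrite -map_mxM wd map_mx0.
rewrite map_mxM map_mxD map_mx1 map_mxM; apply: elem_colM => //.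
by rewrite -map_mxM cu map_mx0.
Qed.

(** * Lifting transvections by clearing denominators *)

Section Liftable.
Variables (C K : comNzRingType) (f : {rmorphism C -> K}) (Sg : C -> Prop).
Hypothesis Sg1 : Sg 1.
Hypothesis SgM : forall a b, Sg a -> Sg b -> Sg (a * b).
Hypothesis clear : forall x : K, exists s a, Sg s /\ f s * x = f a.
Variables (m : nat) (c : 'rV[C]_m) (d : 'cV[C]_m).
Hypothesis cd : c *m d = 1%:M.

Lemma clear_mx p q (A : 'M[K]_(p, q)) :
  exists s A', Sg s /\ f s *: A = map_mx f A'.
Proof.
rewrite [A]matrix_sum_delta pair_bigA /=.
apply: (big_ind (fun B : 'M[K]_(p, q) => exists s A', Sg s /\ f s *: B = map_mx f A')).
- by exists 1, 0; rewrite map_mx0 scaler0.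
- move=> B1 B2 [s1 [A1 [S1 E1]]] [s2 [A2 [S2 E2]]].
  exists (s1 * s2), (s2 *: A1 + s1 *: A2); split; first exact: SgM.
  rewrite map_mxD !map_mxZ -E1 -E2 scalerDr !scalerA rmorphM.
  by rewrite [f s2 * _]mulrC.
- move=> [i j] _ /=; have [s [a [Ss E]]] := clear (A i j).
  exists s, (a *: delta_mx i j); split=> //.
  by rewrite map_mxZ map_delta_mx scalerA E.
Qed.

(* Quantifying over all multiples [b] makes this closed under commutators. *)
Definition liftable (N : 'M[K]_m) : Prop :=
  exists s, Sg s /\ forall b : C,
    exists2 h, elem c d h & map_mx f h = 1%:M + f (s * b) *: N.

Local Notation ck := (map_mx f c).
Local Notation dk := (map_mx f d).

Let ckdk : ck *m dk = 1%:M. Proof. by rewrite -map_mxM cd map_mx1. Qed.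

Lemma liftable0 : liftable 0.
Proof.
exists 1; split=> // b; exists 1%:M; first exact: elem1.
by rewrite map_mx1 scaler0 addr0.
Qed.

Lemma liftable_row w : w *m dk = 0 -> liftable (dk *m w).
Proof.
move=> wd; have [s [w' [Ss E]]] := clear_mx w; exists s; split=> // b.
(* The lift [w'] need not annihilate [d] over [C]. The projection [1 - d c] forces this, and it
   leaves the image unchanged because [w] annihilates [dk]. *)
exists (1%:M + d *m (b *: w' *m (1%:M - d *m c))).
  by apply: elem_row; rewrite -mulmxA mulmxBl mul1mx -mulmxA cd mulmx1 subrr mulmx0.
rewrite map_mxD map_mx1 !map_mxM map_mxB map_mxZ map_mx1 map_mxM -E.
congr (_ + _); rewrite -!scalemxAl -!scalemxAr mulmxBr mulmx1 mulmxA wd mul0mx subr0.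
by rewrite !scalerA rmorphM mulrC.
Qed.

Lemma liftable_col u : ck *m u = 0 -> liftable (u *m ck).
Proof.
move=> cu; have [s [u' [Ss E]]] := clear_mx u; exists s; split=> // b.
exists (1%:M + ((1%:M - d *m c) *m (b *: u')) *m c).
  by apply: elem_col; rewrite mulmxA mulmxBr mulmx1 mulmxA cd mul1mx subrr mul0mx.
rewrite map_mxD map_mx1 !map_mxM map_mxB map_mxZ map_mx1 map_mxM -E.
congr (_ + _); rewrite scalerA -scalemxAr mulmxBl mul1mx -mulmxA cu mulmx0 subr0.
by rewrite -scalemxAl rmorphM mulrC.
Qed.

Lemma liftableZ a N : liftable N -> liftable (a *: N).
Proof.
move=> [s [Ss Hs]]; have [r [a' [Sr E]]] := clear a.
exists (r * s); split=> [|b]; first exact: SgM.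
have [h Eh hE] := Hs (a' * b); exists h => //.
rewrite hE scalerA; congr (_ + _ *: _).
rewrite !rmorphM -E; set t := f s; set t' := f r; set e := f b.
by rewrite !mulrA [t * t']mulrC -!mulrA [e * a]mulrC.
Qed.

Lemma liftableD N1 N2 :
  liftable N1 -> liftable N2 -> N1 *m N2 = 0 -> liftable (N1 + N2).
Proof.
move=> [s1 [S1 H1]] [s2 [S2 H2]] e; exists (s1 * s2); split=> [|b]; first exact: SgM.
(* Each factor takes the denominator of the other, so that both carry the same multiplier
   [s1 * s2 * b]. *)
have [h1 E1 h1E] := H1 (s2 * b); have [h2 E2 h2E] := H2 (s1 * b).
exists (h1 *m h2); first exact: elemM.
rewrite map_mxM h1E h2E mulmxDl mul1mx mulmxDr mulmx1 -scalemxAl -scalemxAr e.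
rewrite !scaler0 addr0 scalerDr [s2 * (s1 * b)]mulrCA !mulrA.
by rewrite addrAC addrA.
Qed.

(** The left side is a commutator, since [1 - A] and [1 - B] invert [1 + A] and [1 + B]. *)
Lemma comm_mx_nilp (R : pzRingType) (A B : 'M[R]_m) :
  B *m A = 0 -> A *m A = 0 -> B *m B = 0 ->
  (1%:M + A) *m (1%:M + B) *m ((1%:M - A) *m (1%:M - B)) = 1%:M + A *m B.
Proof.
move=> BA AA BB.
have -> : (1%:M - A) *m (1%:M - B) = 1%:M - A - B + A *m B.
  by rewrite mulmxBl mul1mx mulmxBr mulmx1 opprB [A *m B - A]addrC !addrA
     [1%:M - B - A]addrAC.
rewrite -mulmxA; have -> : (1%:M + B) *m (1%:M - A - B + A *m B) = 1%:M - A + A *m B.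
  rewrite mulmxDl mul1mx mulmxDr !mulmxBr mulmx1 BA BB mulmxA BA mul0mx.
  by rewrite subr0 subr0 addr0 addrAC addrNK.
rewrite mulmxDl mul1mx mulmxDr mulmxBr mulmx1 AA mulmxA AA mul0mx subr0 addr0.
by rewrite addrAC addrNK.
Qed.

Lemma liftableM N1 N2 : liftable N1 -> liftable N2 -> N2 *m N1 = 0 ->
  N1 *m N1 = 0 -> N2 *m N2 = 0 -> liftable (N1 *m N2).
Proof.
move=> [s1 [S1 H1]] [s2 [S2 H2]] e e1 e2; exists (s1 * s2); split=> [|b]; first exact: SgM.
(* The multiplier [b] is put in the second factor alone, as the commutator is bilinear; the inverse
   factors come from [-1] and [-b]. *)
have [h1 E1 h1E] := H1 1; have [h1' E1' h1'E] := H1 (- 1).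
have [h2 E2 h2E] := H2 b; have [h2' E2' h2'E] := H2 (- b).
exists ((h1 *m h2) *m (h1' *m h2')); first by do 2!apply: elemM.
rewrite !map_mxM h1E h2E h1'E h2'E mulr1 mulrN1 mulrN !rmorphN !scaleNr.
rewrite comm_mx_nilp -?scalemxAl -?scalemxAr ?e ?e1 ?e2 ?scaler0 //.
by rewrite scalerA -mulrA !rmorphM.
Qed.

(** Since [c d = 1], inserting [ck *m dk] between [x] and [y] writes [x y] as a product of a column
    and a row transvection part, hence as a commutator. *)
Lemma liftable_mix (x : 'cV_m) (y : 'rV_m) :
  ck *m x = 0 -> y *m dk = 0 -> y *m x = 0 -> liftable (x *m y).
Proof.
move=> cx yd yx.
have -> : x *m y = (x *m ck) *m (dk *m y) by rewrite mulmxA -(mulmxA x) ckdk mulmx1.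
apply: liftableM; [exact: liftable_col | exact: liftable_row | | | ].
- by rewrite mulmxA -(mulmxA dk) yx mulmx0 mul0mx.
- by rewrite mulmxA -(mulmxA x) cx mulmx0 mul0mx.
- by rewrite mulmxA -(mulmxA dk) yd mulmx0 mul0mx.
Qed.

Variables (i0 : 'I_m) (l : K).
Hypothesis l_inv : l * f (d i0 0) = 1.

(** A change of basis over [K] taking the pair [(ck, dk)] to the standard pair at [i0]; it rests on
    the coordinate [i0] of [dk] being invertible. *)
Lemma unimodular_coordinates : exists F G : 'M[K]_m,
  [/\ G *m F = 1%:M, col i0 F = dk & row i0 G = ck].
Proof.
pose e : 'cV[K]_m := delta_mx i0 0; pose eT : 'rV[K]_m := delta_mx 0 i0.
have eTe : eT *m e = 1%:M.
  by rewrite mul_delta_mx; apply/matrixP => a b; rewrite !mxE !ord1.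
(* [pi] projects onto the kernel of [ck] along [dk], and [omega] onto the hyperplane [eT = 0] along
   [dk]. Their restrictions are inverse isomorphisms between these two complements of [dk]; [rho]
   projects onto the hyperplane along [e]. *)
pose rho := 1%:M - e *m eT; pose pi := 1%:M - dk *m ck.
pose omega := 1%:M - l *: (dk *m eT).
have eTd : eT *m dk = (f (d i0 0))%:M.
  by rewrite -rowE; apply/matrixP => a b; rewrite !mxE !ord1 mulr1n.
have eTrho : eT *m rho = 0 by rewrite mulmxBr mulmx1 mulmxA eTe mul1mx subrr.
have rhoe : rho *m e = 0 by rewrite mulmxBl mul1mx -mulmxA eTe mulmx1 subrr.
have omd : omega *m dk = 0.
  by rewrite mulmxBl mul1mx -scalemxAl -mulmxA eTd mul_mx_scalar scalerA l_inv scale1r subrr.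
have ompi : omega *m pi = omega.
  by rewrite /pi (mulmxBr omega) mulmx1 mulmxA omd mul0mx subr0.
have omrho : omega *m rho = rho.
  by rewrite (mulmxBl _ _ rho) mul1mx -scalemxAl -mulmxA eTrho mulmx0 scaler0 subr0.
have rho2 : rho *m rho = rho.
  by rewrite (mulmxBr rho) mulmx1 mulmxA rhoe mul0mx subr0.
have cpi : ck *m pi = 0 by rewrite mulmxBr mulmx1 mulmxA ckdk mul1mx subrr.
exists (pi *m rho + dk *m eT), (e *m ck + rho *m omega); split.
- rewrite mulmxDl (mulmxDr (e *m ck)) (mulmxDr (rho *m omega)).
  have -> : e *m ck *m (pi *m rho) = 0 by rewrite mulmxA -(mulmxA e) cpi mulmx0 mul0mx.
  have -> : e *m ck *m (dk *m eT) = e *m eT by rewrite mulmxA -(mulmxA e) ckdk mulmx1.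
  have -> : rho *m omega *m (dk *m eT) = 0 by rewrite mulmxA -(mulmxA rho) omd mulmx0 mul0mx.
  have -> : rho *m omega *m (pi *m rho) = rho.
    by rewrite mulmxA -(mulmxA rho) ompi -mulmxA omrho rho2.
  by rewrite add0r addr0 addrC subrK.
- by rewrite colE mulmxDl -!mulmxA rhoe eTe mulmx1 mulmx0 add0r.
- by rewrite rowE mulmxDr !mulmxA eTe mul1mx eTrho mul0mx addr0.
Qed.

(** In the new coordinates the liftable matrices are transvection closed: the matrix unit at
    [(i, j)] becomes [col i F *m row j G], which is of row type if [i = i0], of column type if
    [j = i0], and of mixed type otherwise. *)
Lemma liftable_unimodular_nilp N : (2 < m)%N -> unimodular_nilp N -> liftable N.
Proof.
move=> m3 uN; have [F [G [GF Fd Gc]]] := unimodular_coordinates.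
have FG := mulmx1C GF.
have -> : N = F *m (G *m N *m F) *m G.
  by rewrite !mulmxA FG mul1mx -mulmxA FG mulmx1.
have uN' := unimodular_nilp_conj FG uN.
apply: (tcl_unimodular_nilp (P := fun N => liftable (F *m N *m G)) _ m3 uN').
have conjM A B : (F *m A *m G) *m (F *m B *m G) = F *m (A *m B) *m G.
  by rewrite !mulmxA -(mulmxA _ G F) GF mulmx1.
split.
- by rewrite mulmx0 mul0mx; apply: liftable0.
- by move=> a A; rewrite -scalemxAr -scalemxAl; apply: liftableZ.
- move=> A B LA LB AB; rewrite mulmxDr mulmxDl; apply: liftableD => //.
  by rewrite conjM AB mulmx0 mul0mx.
- move=> A B LA LB BA AA BB; rewrite -conjM; apply: liftableM => //;
  by rewrite conjM ?BA ?AA ?BB mulmx0 mul0mx.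
- move=> i j ij.
  have GFij a b : a != b -> row a G *m col b F = 0.
    move=> ab; rewrite rowE colE mulmxA -(mulmxA _ G) GF mulmx1.
    by rewrite mul_delta_mx_0.
  have -> : F *m delta_mx i j *m G = col i F *m row j G.
    by rewrite rowE colE mulmxA -(mulmxA F (delta_mx i 0)) mul_delta_mx.
  have [ei|ni] := eqVneq i i0.
    by rewrite ei Fd; apply: liftable_row; rewrite -Fd -ei GFij // eq_sym.
  have [ej|nj] := eqVneq j i0.
    by rewrite ej Gc; apply: liftable_col; rewrite -Gc -ej GFij // eq_sym.
  by apply: liftable_mix; rewrite -?Gc -?Fd GFij // eq_sym.
Qed.

End Liftable.

(** * Pfaffians *)

Section Matchings.
Variable k : nat.
Hypothesis even_size : ~~ odd (1 + k).
Local Notation T := 'I_(1 + k).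
Local Notation h := ((1 + k)./2).

Let fst_pt (i : 'I_h) : T := inord i.*2.
Let snd_pt (i : 'I_h) : T := inord i.*2.+1.

Let snd_lt (i : 'I_h) : (i.*2.+1 < 1 + k)%N.
Proof.
have := ltn_ord i; rewrite -ltn_double => lt_i.
by move: (odd_double_half (1 + k)); rewrite (negbTE even_size) add0n; lia.
Qed.

Let fstE i : fst_pt i = i.*2 :> nat.
Proof. by rewrite inordK // ltnW // snd_lt. Qed.

Let sndE i : snd_pt i = i.*2.+1 :> nat.
Proof. by rewrite inordK // snd_lt. Qed.

Let fst_inj : injective fst_pt.
Proof. by move=> i j /(congr1 val); rewrite /= !fstE => /double_inj /val_inj. Qed.

Let snd_inj : injective snd_pt.
Proof. by move=> i j /(congr1 val); rewrite /= !sndE => -[] /double_inj /val_inj. Qed.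

Let fst_snd i j : fst_pt i != snd_pt j.
Proof. by apply/negP=> /eqP /(congr1 val) /=; rewrite fstE sndE; lia. Qed.

Let ptP (x : T) : exists i, x = fst_pt i \/ x = snd_pt i.
Proof.
have lt_x : (x./2 < h)%N.
  by rewrite -ltn_double; move: (odd_double_half x) (odd_double_half (1 + k)) (ltn_ord x);
     rewrite (negbTE even_size) add0n; lia.
exists (Ordinal lt_x); case ox: (odd x); [right | left]; apply/val_inj;
  by rewrite /= ?fstE ?sndE /= -{1}(odd_double_half x) ox.
Qed.

(** The reference matching of [2i] with [2i+1], seen as an involution. Its conjugate by [s] is the
    matching that [s] describes, so equality of matchings becomes equality of conjugates. *)
Let om (x : T) : T := if odd x then inord x.-1 else inord x.+1.

Let om_fst i : om (fst_pt i) = snd_pt i.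
Proof. by rewrite /om fstE odd_double. Qed.

Let om_snd i : om (snd_pt i) = fst_pt i.
Proof. by rewrite /om sndE /= odd_double. Qed.

Let omK : involutive om.
Proof. by move=> x; have [i [->|->]] := ptP x; rewrite !(om_fst, om_snd). Qed.

Let omega : {perm T} := perm (inv_inj omK).

Let omega_fst i : omega (fst_pt i) = snd_pt i. Proof. by rewrite permE om_fst. Qed.
Let omega_snd i : omega (snd_pt i) = fst_pt i. Proof. by rewrite permE om_snd. Qed.

Let mate_fst (s : {perm T}) i : (omega ^ s)%g (s (fst_pt i)) = s (snd_pt i).
Proof. by rewrite permJ omega_fst. Qed.

Let mate_snd (s : {perm T}) i : (omega ^ s)%g (s (snd_pt i)) = s (fst_pt i).
Proof. by rewrite permJ omega_snd. Qed.

(** The moves preserving a matching: reversing one edge, and exchanging two edges. Both commute with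
    [omega]. *)
Let flip i := tperm (fst_pt i) (snd_pt i).
Let swap i j := (tperm (fst_pt i) (fst_pt j) * tperm (snd_pt i) (snd_pt j))%g.

Let conj_fix (z s : {perm T}) : (z ^ omega = z)%g -> (omega ^ (z * s) = omega ^ s)%g.
Proof.
move=> e; rewrite conjgM; congr (_ ^ _)%g.
by move/conjg_fixP/commgP: e => e; apply/conjg_fixP/commgP; rewrite /commute.
Qed.

Let flip_fix i : (flip i ^ omega = flip i)%g.
Proof. by rewrite tpermJ omega_fst omega_snd tpermC. Qed.

Let swap_fix i j : (swap i j ^ omega = swap i j)%g.
Proof.
rewrite conjMg !tpermJ !omega_fst !omega_snd.
have : (tperm (fst_pt i) (fst_pt j) ^ tperm (snd_pt i) (snd_pt j) =
        tperm (fst_pt i) (fst_pt j))%g.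
  by rewrite tpermJ !tpermD // eq_sym.
by move/conjg_fixP/commgP.
Qed.

Let swap_fst i j l : swap i j (fst_pt l) = fst_pt (tperm i j l).
Proof.
rewrite permM; case: (tpermP i j l) => [->|->|/eqP li /eqP lj].
- by rewrite tpermL tpermD // eq_sym.
- by rewrite tpermR tpermD // eq_sym.
- by rewrite !tpermD // ?(inj_eq fst_inj) 1?eq_sym // eq_sym.
Qed.

Let swap_snd i j l : swap i j (snd_pt l) = snd_pt (tperm i j l).
Proof.
rewrite permM (@tpermD _ (fst_pt i)) // ; case: (tpermP i j l) => [->|->|/eqP li /eqP lj].
- by rewrite tpermL.
- by rewrite tpermR.
- by rewrite tpermD // (inj_eq snd_inj) eq_sym.
Qed.

Let swapM_fst i j (s : {perm T}) l : (swap i j * s)%g (fst_pt l) = s (fst_pt (tperm i j l)).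
Proof. by rewrite (permM (swap i j)) swap_fst. Qed.

Let swapM_snd i j (s : {perm T}) l : (swap i j * s)%g (snd_pt l) = s (snd_pt (tperm i j l)).
Proof. by rewrite (permM (swap i j)) swap_snd. Qed.

Let hw : nat := h.
(** The coefficients are positive and decrease with [i], so the weight drops when an edge is
    reversed to start at its smaller end, or when two edges are put in increasing order. Minimal
    permutations are therefore canonical. *)
Let weight (s : {perm T}) : nat := (\sum_(i < h) (hw - i) * s (fst_pt i))%N.

Let weight_flip (s : {perm T}) i : (s (snd_pt i) < s (fst_pt i))%N ->
  (weight (flip i * s)%g < weight s)%N.
Proof.
move=> lt; rewrite /weight (bigD1 i) //= [X in (_ < X)%N](bigD1 i) //=.
rewrite permM tpermL (eq_bigr (fun l : 'I_h => (hw - l) * s (fst_pt l))%N).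
  by rewrite ltn_add2r ltn_pmul2l // subn_gt0 ltn_ord.
move=> l li; rewrite permM tpermD // ?(inj_eq fst_inj) 1?eq_sym //.
Qed.

Let weight_swap (s : {perm T}) (i j : 'I_h) : (i < j)%N -> (s (fst_pt j) < s (fst_pt i))%N ->
  (weight (swap i j * s)%g < weight s)%N.
Proof.
move=> ij lt.
have ji : j != i by apply/eqP => e; rewrite e ltnn in ij.
rewrite /weight (bigD1 i) //= (bigD1 j) //= [X in (_ < X)%N](bigD1 i) //=.
rewrite [X in (_ < _ + X)%N](bigD1 j) //=.
rewrite !swapM_fst tpermL tpermR !addnA.
rewrite (eq_bigr (fun l : 'I_h => (hw - l) * s (fst_pt l))%N); last first.
  by move=> l /andP [li lj]; rewrite swapM_fst tpermD // eq_sym.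
rewrite ltn_add2r; have : (j < hw)%N := ltn_ord j; move: ij lt.
move: (nat_of_ord (s (fst_pt i))) (nat_of_ord (s (fst_pt j))) => p q.
move: hw (nat_of_ord i) (nat_of_ord j) => n a b ab qp bn.
(* The two sides differ by [(b - a) * (p - q)]. *)
have -> : (n - a = (n - b) + (b - a))%N by lia.
rewrite -(subnKC (ltnW qp)); have : (0 < (b - a) * (p - q))%N by rewrite muln_gt0; lia.
by move: (n - b)%N (b - a)%N (p - q)%N => u v w; nia.
Qed.

Section Term.
Variables (R : comNzRingType) (B : 'M[R]_(1 + k)).
Hypothesis antiB : forall x y, B x y = - B y x.

Definition pf_term (s : {perm T}) : R :=
  (-1) ^+ s * \prod_(i < h) B (s (inord i.*2)) (s (inord i.*2.+1)).

Let pf_termE s : pf_term s = (-1) ^+ s * \prod_(i < h) B (s (fst_pt i)) (s (snd_pt i)).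
Proof. by []. Qed.

(** The sign of the transposition cancels against the antisymmetry of [B]. *)
Let term_flip s i : pf_term (flip i * s)%g = pf_term s.
Proof.
rewrite !pf_termE odd_permM odd_tperm fst_snd (bigD1 i) //= [in RHS](bigD1 i) //=.
rewrite !permM tpermL tpermR antiB.
rewrite (eq_bigr (fun l => B (s (fst_pt l)) (s (snd_pt l)))); last first.
  move=> l li; rewrite !permM !tpermD // 1?eq_sym ?fst_snd // ?(inj_eq fst_inj) ?(inj_eq snd_inj) //.
by rewrite mulNr mulrN -mulNr; case: (odd_perm s); rewrite ?expr1 ?expr0 ?opprK.
Qed.

(** Two transpositions keep the sign, and the product is only reindexed. *)
Let term_swap s i j : i != j -> pf_term (swap i j * s)%g = pf_term s.
Proof.
move=> ij; rewrite !pf_termE !odd_permM !odd_tperm.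
rewrite (inj_eq fst_inj) (inj_eq snd_inj) ij /=; congr (_ * _).
rewrite [RHS](reindex_inj (@perm_inj _ (tperm i j))) /=; apply: eq_bigr => l _.
by rewrite swapM_fst swapM_snd.
Qed.

(* Minimising [weight] over permutations with the same matching and the same term
   avoids computing the sign of permutations that commute with [omega]. *)
Lemma pf_canon_ex s : exists s' : {perm T},
  [/\ pf_canon s', (omega ^ s' = omega ^ s)%g & pf_term s' = pf_term s].
Proof.
pose Q (s' : {perm T}) := ((omega ^ s')%g == (omega ^ s)%g) && (pf_term s' == pf_term s).
have Qs : Q s by rewrite /Q !eqxx.
case: (arg_minnP weight Qs) => s' /andP [/eqP e1 /eqP e2] min.
have stable z : (z ^ omega = z)%g -> pf_term (z * s')%g = pf_term s' ->
    ~~ (weight (z * s')%g < weight s')%N.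
  by move=> ez tz; rewrite -leqNgt; apply: min; rewrite /Q conj_fix // e1 tz e2 !eqxx.
exists s'; split=> //; apply/andP; split.
  apply/forallP => i; have := stable _ (flip_fix i) (term_flip s' i).
  apply: contraR; rewrite -leqNgt leq_eqVlt => /orP [/eqP /val_inj /perm_inj e|lt].
    by have := fst_snd i i; rewrite /fst_pt -e eqxx.
  exact: weight_flip.
apply/forallP => i; apply/forallP => j; apply/implyP => ij.
have ne : i != j by apply/eqP => e; rewrite e ltnn in ij.
have := stable _ (swap_fix i j) (term_swap s' ne).
apply: contraR; rewrite -leqNgt leq_eqVlt => /orP [/eqP /val_inj /perm_inj e|lt].
  by move/fst_inj: e ne => ->; rewrite eqxx.
exact: weight_swap.
Qed.
End Term.

Let lower_enum (s : {perm T}) : pf_canon s ->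
  sorted (fun x y : T => (x < y)%N) [seq s (fst_pt i) | i <- enum 'I_h] /\
  [seq s (fst_pt i) | i <- enum 'I_h] =i [pred x : T | (x < (omega ^ s)%g x)%N].
Proof.
case/andP => /forallP c1 /forallP c2; split.
  rewrite sorted_map; apply: (@sub_sorted _ (relpre val ltn)).
    by move=> i j /= ij; have /forallP /(_ j) /implyP := c2 i; apply.
  by rewrite -sorted_map val_enum_ord iota_ltn_sorted.
move=> x; rewrite inE /= -{2 3}(permKV s x); set y := (s^-1)%g x.
apply/mapP/idP => [[i _ xE]|].
  have -> : y = fst_pt i by rewrite /y xE permK.
  by rewrite mate_fst; apply: c1.
have [i [yE|yE]] := ptP y; first by exists i; rewrite ?mem_enum // -yE permKV.
by rewrite yE mate_snd ltnNge ltnW //; apply: c1.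
Qed.

(** The matching determines the set of lower ends of its edges. A canonical permutation lists this
    set in increasing order, and the upper ends follow as mates. *)
Let canon_uniq (s s' : {perm T}) : pf_canon s -> pf_canon s' ->
  (omega ^ s = omega ^ s')%g -> s = s'.
Proof.
move=> cs cs' e; have [so1 m1] := lower_enum cs; have [so2 m2] := lower_enum cs'.
have /eq_in_map E : [seq s (fst_pt i) | i <- enum 'I_h] = [seq s' (fst_pt i) | i <- enum 'I_h].
  apply: (irr_sorted_eq _ _ so1 so2).
  - by move=> x y z; apply: ltn_trans.
  - by move=> x; rewrite ltnn.
  - by move=> x; rewrite m1 m2 !inE e.
have Ef i : s (fst_pt i) = s' (fst_pt i) by apply: E; rewrite mem_enum.
apply/permP => x; have [i [->|->]] := ptP x; first exact: Ef.
by rewrite -!mate_fst e Ef.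
Qed.

(** A sign-reversing involution: exchanging [r] and [l] in a matching negates its term, and the
    matchings it fixes contain the edge from [r] to [l], where [B] vanishes. *)
Lemma pfaffian_equal_rows (R : comNzRingType) (B : 'M[R]_(1 + k)) r l :
  (forall x y, B x y = - B y x) -> (forall x, B x x = 0) -> r != l ->
  (forall y, B r y = B l y) -> pfaffian B = 0.
Proof.
move=> antiB altB rl eqrl; pose t := tperm r l.
have Bt x y : B (t x) (t y) = B x y.
  have Bl u v : B (t u) v = B u v by rewrite /t; case: tpermP => [->|->|//]; rewrite eqrl.
  by rewrite Bl antiB Bl -antiB.
have term_t s : pf_term B (s * t)%g = - pf_term B s.
  rewrite /pf_term odd_permM odd_tperm rl addbT.
  rewrite (eq_bigr (fun i : 'I_h => B (s (inord i.*2)) (s (inord i.*2.+1)))).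
    by rewrite -mulNr; case: (odd_perm s); rewrite ?expr1 ?expr0 ?opprK.
  by move=> i _; rewrite !permM Bt.
(* [g s] is the canonical form of [s * t]. The default value never occurs, by [pf_canon_ex]. *)
pose g s := odflt s [pick s' : {perm T} | [&& pf_canon s',
   (omega ^ s')%g == (omega ^ (s * t))%g & pf_term B s' == pf_term B (s * t)%g]].
have gP s : [/\ pf_canon (g s), (omega ^ g s = omega ^ (s * t))%g &
    pf_term B (g s) = - pf_term B s].
  rewrite /g; case: pickP => [s' /and3P [cs /eqP e1 /eqP e2]|none] /=.
    by split; rewrite // e2 term_t.
  have [s' [cs e1 e2]] := pf_canon_ex antiB (s * t)%g.
  by have := none s'; rewrite cs e1 e2 !eqxx.
have gK s : pf_canon s -> g (g s) = s.
  move=> cs; have [c1 e1 _] := gP s; have [c2 e2 _] := gP (g s).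
  by apply: canon_uniq => //; rewrite e2 conjgM e1 -conjgM -mulgA tperm2 mulg1.
have gfix s : g s = s -> pf_term B s = 0.
  (* Here [t] commutes with the matching. If the mate of [r] were not [l], then [r] and [l] would
     share a mate. *)
  move=> gs; have [_ e _] := gP s; rewrite gs conjgM in e.
  have e' : (t ^ (omega ^ s) = t)%g.
    by move/esym/conjg_fixP/commgP: e => e; apply/conjg_fixP/commgP; rewrite /commute.
  pose x := (s^-1)%g r; have rE : r = s x by rewrite permKV.
  have mr : (omega ^ s)%g r = l.
    apply/eqP/negPn/negP => ml.
    have mrr : (omega ^ s)%g r != r.
      rewrite rE permJ; apply/eqP => /perm_inj.
      have [i [->|->]] := ptP x; rewrite ?omega_fst ?omega_snd => /eqP.
        by rewrite eq_sym (negbTE (fst_snd _ _)).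
      by rewrite (negbTE (fst_snd _ _)).
    have := permJ t (omega ^ s)%g r; rewrite e' tpermL tpermD 1?eq_sym //.
    by move/perm_inj => e0; rewrite e0 eqxx in rl.
  have [i xi] := ptP x.
  suff B0 : B (s (fst_pt i)) (s (snd_pt i)) = 0.
    by rewrite /pf_term (bigD1 i) //= B0 mul0r mulr0.
  case: xi => xi; rewrite xi in rE.
    by have := mate_fst s i; rewrite -rE mr => <-; rewrite eqrl altB.
  by have := mate_snd s i; rewrite -rE mr => <-; rewrite antiB eqrl altB oppr0.
rewrite /pfaffian; change (\sum_(s | pf_canon s) pf_term B s = 0).
(* Doubling the sum would lose information in characteristic 2, so an enumeration picks one element
   from each pair [s], [g s]. *)
pose rk (s : {perm T}) : nat := enum_rank s.
rewrite (bigID (fun s => rk s < rk (g s))%N) /=.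
rewrite [X in _ + X](bigID (fun s => rk (g s) < rk s)%N) /=.
rewrite [X in _ + (_ + X)]big1 ?addr0; last first.
  move=> s; rewrite -!leqNgt => /andP [/andP [_ h1] h2]; apply: gfix.
  by apply: enum_rank_inj; apply/val_inj/eqP; rewrite eqn_leq; apply/andP.
rewrite [X in _ + X](reindex_onto g g) /=; last by move=> s /andP [/andP [cs _] _]; apply: gK.
rewrite [X in _ + X](eq_bigl (fun s => pf_canon s && (rk s < rk (g s))%N)); last first.
  move=> s; have [cg _ _] := gP s; rewrite cg /=; apply/idP/idP.
    case/andP=> /andP [_ lt] /eqP gs; rewrite gs in lt; rewrite lt andbT.
    by have [] := gP (g s); rewrite gs.
  by case/andP => cs lt; rewrite gK // lt eqxx -leqNgt ltnW.
rewrite -big_split big1 //= => s _; have [_ _ ->] := gP s.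
by rewrite subrr.
Qed.

(** Column [r] is overwritten along with row [r], and the value [v r] is ignored, so that an
    alternating [A] stays alternating. *)
Definition replace_row (R : comNzRingType) (A : 'M[R]_(1 + k)) (r : T) (v : T -> R) :
    'M[R]_(1 + k) :=
  \matrix_(x, y) if x == r then if y == r then 0 else v y
                 else if y == r then - v x else A x y.

Let pf_term_linear (R : comNzRingType) (A : 'M[R]_(1 + k)) r s :
  exists jc : T * R, forall v, pf_term (replace_row A r v) s = v jc.1 * jc.2.
Proof.
pose x := (s^-1)%g r; have rE : r = s x by rewrite permKV.
have [i xi] := ptP x.
pose kap := \prod_(l | l != i) A (s (fst_pt l)) (s (snd_pt l)).
have rest v : \prod_(l | l != i) replace_row A r v (s (fst_pt l)) (s (snd_pt l)) = kap.
  apply: eq_bigr => l li; rewrite mxE rE !(inj_eq perm_inj).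
  case: xi => ->; rewrite ?(inj_eq fst_inj) ?(inj_eq snd_inj) (negbTE li).
    by rewrite eq_sym (negbTE (fst_snd _ _)).
  by rewrite (negbTE (fst_snd _ _)).
case: xi => xi; rewrite xi in rE.
- exists (s (snd_pt i), (-1) ^+ s * kap) => v; rewrite /pf_term (bigD1 i) //= rest mxE.
  rewrite {1}rE eqxx {1}rE (inj_eq perm_inj) eq_sym (negbTE (fst_snd _ _)).
  by rewrite mulrCA.
- exists (s (fst_pt i), - ((-1) ^+ s * kap)) => v; rewrite /pf_term (bigD1 i) //= rest mxE.
  rewrite {1}rE (inj_eq perm_inj) (negbTE (fst_snd _ _)) {1}rE eqxx.
  by rewrite mulNr !mulrN mulrCA.
Qed.

Let pfaffian_linear (R : comNzRingType) (A : 'M[R]_(1 + k)) r :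
  exists w : T -> R, forall v, pfaffian (replace_row A r v) = \sum_y v y * w y.
Proof.
have [jc jcE] := fin_all_exists (pf_term_linear A r).
exists (fun y => \sum_(s | pf_canon s && ((jc s).1 == y)) (jc s).2) => v.
rewrite /pfaffian (partition_big (fun s => (jc s).1) predT) //=.
apply: eq_bigr => y _; rewrite mulr_sumr; apply: eq_bigr => s /andP [_ /eqP <-].
exact: jcE.
Qed.

(** The Pfaffian analogue of the adjugate. Column [r] of [W] holds the coefficients of the Pfaffian
    as a linear form in row [r]; evaluating it at row [l] of [A] gives back the Pfaffian if [l = r],
    and a matrix with two equal rows otherwise. *)
Lemma pfaffian_adjoint (R : comNzRingType) (A : 'M[R]_(1 + k)) :
  alternating A -> exists W, A *m W = (pfaffian A)%:M.
Proof.
move=> [N AE].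
have antiA x y : A x y = - A y x by rewrite AE !mxE opprB.
have altA x : A x x = 0 by rewrite AE !mxE subrr.
have [w wE] := fin_all_exists (pfaffian_linear A).
exists (\matrix_(y, r) w r y); apply/matrixP => l r; rewrite !mxE.
under eq_bigr => y _ do rewrite mxE.
rewrite -wE; have [->|lr] := eqVneq l r.
  rewrite mulr1n; congr pfaffian; apply/matrixP => x y; rewrite mxE.
  by case: eqVneq => [->|_]; case: eqVneq => [->|_] //; rewrite ?altA // -antiA.
rewrite mulr0n; apply: (@pfaffian_equal_rows _ _ r l).
- move=> x y; rewrite !mxE.
  by do 2!case: eqVneq => _; rewrite ?oppr0 ?opprK.
- by move=> x; rewrite mxE; case: eqVneq => _ //; rewrite altA.
- by rewrite eq_sym.
- move=> y; rewrite !mxE eqxx (negbTE lr).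
  by case: eqVneq => // _; rewrite altA oppr0.
Qed.

End Matchings.

(** * Maximal ideals and localization *)

Lemma maximal_ideal_ex (R : comNzRingType) (J : R -> Prop) :
  ideal J -> ~ J 1 -> exists m, maximal_ideal m /\ forall a, J a -> m a.
Proof.
move=> idJ J1.
pose Q (A : R -> Prop) := (forall x, ~ A x) \/ [/\ ideal A, forall a, J a -> A a & ~ A 1].
have [|A [QA maxA]] := @classical_sets.Zorn_bigcup R Q.
  move=> F FQ totF.
  have [[A0 [FA0 [x0 Ax0]]]|none] :=
      classic (exists A, F A /\ exists x, A x); last first.
    by left=> x [A FA Ax]; apply: none; exists A; split=> //; exists x.
  have good A : F A -> (exists x, A x) -> [/\ ideal A, forall a, J a -> A a & ~ A 1].
    by move=> FA [x Ax]; case: (FQ _ FA) => // /(_ x).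
  have [[A00 _ _] JA0 _] := good _ FA0 (ex_intro _ _ Ax0).
  right; split; first split.
  - by exists A0.
  - move=> a b [A FA Aa] [B FB Bb].
    have [[_ AD _] _ _] := good _ FA (ex_intro _ _ Aa).
    have [[_ BD _] _ _] := good _ FB (ex_intro _ _ Bb).
    case: (totF _ _ FA FB) => sub; first by exists B => //; apply: BD => //; apply: sub.
    by exists A => //; apply: AD => //; apply: sub.
  - move=> r a [A FA Aa]; have [[_ _ AM] _ _] := good _ FA (ex_intro _ _ Aa).
    by exists A => //; apply: AM.
  - by move=> a Ja; exists A0 => //; apply: JA0.
  - by move=> [A FA A1]; have [_ _] := good _ FA (ex_intro _ _ A1).
case: QA => [A0|[idA JA A1]].
  case: (maxA J); last by right.
  by split=> [x /A0 //|sub]; case: idJ => /sub /A0.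
exists A; split=> //; split=> // B idB AB.
have [B1|B1] := classic (B 1); [by right | left=> a; split; last exact: AB].
move=> Ba; apply: NNPP => nAa; apply: (maxA B).
  by split=> // sub; apply/nAa/sub.
by right; split=> // b /JA /AB.
Qed.

Lemma maximal_ideal_prime (R : comNzRingType) (m : R -> Prop) s t :
  maximal_ideal m -> ~ m s -> ~ m t -> ~ m (s * t).
Proof.
move=> [[m0 mD mM] m1 max] ms mt mst.
pose J x := exists r a, m a /\ x = r * s + a.
have idJ : ideal J.
  split; first by exists 0, 0; rewrite mul0r addr0.
  - move=> x y [r [a [ma ->]]] [r' [a' [ma' ->]]]; exists (r + r'), (a + a').
    by split; [apply: mD | ring].
  - move=> y x [r [a [ma ->]]]; exists (y * r), (y * a).
    by split; [apply: mM | ring].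
have [|e|[r [a [ma e]]]] := max J idJ.
- by move=> a ma; exists 0, a; rewrite mul0r add0r.
- by apply: ms; apply/e; exists 1, 0; rewrite mul1r addr0.
- apply: mt; have -> : t = r * (s * t) + t * a by rewrite -{1}[t]mul1r e; ring.
  by apply: mD; apply: mM.
Qed.

(** Excluding 0 makes the ring of fractions nonzero. *)
Record multset (R : comNzRingType) := Multset {
  mset :> pred R;
  mset1 : mset 1;
  msetM : forall a b, mset a -> mset b -> mset (a * b);
  mset0 : ~~ mset 0 }.

Section Localization.
Variables (R : comNzRingType) (U : multset R).

Definition fracs := {x : R * R | U x.2}.
HB.instance Definition _ := Choice.on fracs.
Implicit Types x y z : fracs.

Definition mkfrac a s (Us : U s) : fracs := exist _ (a, s) Us.
Definition num x : R := (sval x).1.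
Definition den x : R := (sval x).2.
Lemma den_mset x : U (den x). Proof. by case: x. Qed.

(** The factor [u] gives transitivity in the presence of zero divisors. *)
Definition frac_eq x y : Prop := exists u, U u /\ u * (num x * den y - num y * den x) = 0.
(** Excluded middle turns the relation into the boolean one that the quotient construction takes. *)
Definition frac_eqb x y : bool := if excluded_middle_informative (frac_eq x y) then true else false.

Lemma frac_eqP x y : reflect (frac_eq x y) (frac_eqb x y).
Proof. by rewrite /frac_eqb; case: excluded_middle_informative => h; constructor. Qed.

Lemma frac_eqb_refl : reflexive frac_eqb.
Proof. by move=> x; apply/frac_eqP; exists 1; rewrite mset1 subrr mulr0. Qed.

Lemma frac_eqb_sym : symmetric frac_eqb.
Proof.
suff sub x y : frac_eq x y -> frac_eq y x by move=> x y; apply/frac_eqP/frac_eqP; apply: sub.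
by move=> [u [Uu e]]; exists u; split=> //; rewrite -opprB mulrN e oppr0.
Qed.

Lemma frac_eqb_trans : transitive frac_eqb.
Proof.
move=> y x z /frac_eqP [u [Uu e1]] /frac_eqP [v [Uv e2]]; apply/frac_eqP.
exists (u * v * den y); split; first by rewrite !msetM // den_mset.
transitivity (v * den z * (u * (num x * den y - num y * den x)) +
              u * den x * (v * (num y * den z - num z * den y))); first by ring.
by rewrite e1 e2 !mulr0 addr0.
Qed.

Canonical frac_equiv := EquivRel frac_eqb frac_eqb_refl frac_eqb_sym frac_eqb_trans.

Definition localization := {eq_quot frac_eqb}%qT.
HB.instance Definition _ : EqQuotient _ frac_eqb localization := EqQuotient.on localization.
HB.instance Definition _ := Choice.on localization.

Definition loc (x : fracs) : localization := (\pi_localization x)%qT.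

Lemma locP x y : loc x = loc y <-> frac_eq x y.
Proof.
rewrite /loc; split=> [/eqP|/frac_eqP e]; first by rewrite eqmodE => /frac_eqP.
by apply/eqP; rewrite eqmodE.
Qed.

Lemma loc_eq x y : num x * den y = num y * den x -> loc x = loc y.
Proof. by move=> e; apply/locP; exists 1; rewrite mset1 e subrr mulr0. Qed.

Lemma loc_ind (Q : localization -> Prop) : (forall x, Q (loc x)) -> forall p, Q p.
Proof. by move=> h; elim/quotW. Qed.

Lemma frac_eq_repr x : frac_eq (repr (loc x)) x.
Proof. by apply/locP; rewrite /loc reprK. Qed.

Definition addf x y := mkfrac (num x * den y + num y * den x) (msetM (den_mset x) (den_mset y)).
Definition mulf x y := mkfrac (num x * num y) (msetM (den_mset x) (den_mset y)).
Definition oppf x := mkfrac (- num x) (den_mset x).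

Lemma num_mkfrac a s (Us : U s) : num (mkfrac a Us) = a. Proof. by []. Qed.
Lemma den_mkfrac a s (Us : U s) : den (mkfrac a Us) = s. Proof. by []. Qed.
Definition fracE := (num_mkfrac, den_mkfrac).

(** Operations go through chosen representatives; [loc_addE], [loc_mulE] and [loc_oppE] show that
    the choice does not matter. *)
Definition loc_add (p q : localization) := loc (addf (repr p) (repr q)).
Definition loc_mul (p q : localization) := loc (mulf (repr p) (repr q)).
Definition loc_opp (p : localization) := loc (oppf (repr p)).
Definition loc_of (a : R) := loc (mkfrac a (mset1 U)).

Lemma loc_addE x y : loc_add (loc x) (loc y) = loc (addf x y).
Proof.
have [u [Uu e1]] := frac_eq_repr x; have [v [Uv e2]] := frac_eq_repr y.
apply/locP; exists (u * v); split; first by rewrite msetM.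
rewrite !fracE.
move: (repr (loc x)) (repr (loc y)) e1 e2 => x' y' e1 e2.
transitivity (v * den y * den y' * (u * (num x' * den x - num x * den x')) +
              u * den x * den x' * (v * (num y' * den y - num y * den y'))); first by ring.
by rewrite e1 e2 !mulr0 addr0.
Qed.

Lemma loc_mulE x y : loc_mul (loc x) (loc y) = loc (mulf x y).
Proof.
have [u [Uu e1]] := frac_eq_repr x; have [v [Uv e2]] := frac_eq_repr y.
apply/locP; exists (u * v); split; first by rewrite msetM.
rewrite !fracE.
move: (repr (loc x)) (repr (loc y)) e1 e2 => x' y' e1 e2.
transitivity (v * num y' * den y * (u * (num x' * den x - num x * den x')) +
              u * den x' * num x * (v * (num y' * den y - num y * den y'))); first by ring.
by rewrite e1 e2 !mulr0 addr0.
Qed.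

Lemma loc_oppE x : loc_opp (loc x) = loc (oppf x).
Proof.
have [u [Uu e]] := frac_eq_repr x; apply/locP; exists u; split=> //.
rewrite !fracE.
by rewrite !mulNr -opprD mulrN e oppr0.
Qed.

Lemma loc_addA : associative loc_add.
Proof.
elim/loc_ind=> x; elim/loc_ind=> y; elim/loc_ind=> z; rewrite !loc_addE.
by apply: loc_eq; rewrite !fracE; ring.
Qed.

Lemma loc_addC : commutative loc_add.
Proof.
elim/loc_ind=> x; elim/loc_ind=> y; rewrite !loc_addE.
by apply: loc_eq; rewrite !fracE; ring.
Qed.

Lemma loc_add0 : left_id (loc_of 0) loc_add.
Proof.
elim/loc_ind=> x; rewrite loc_addE.
by apply: loc_eq; rewrite !fracE; ring.
Qed.

Lemma loc_addN : left_inverse (loc_of 0) loc_opp loc_add.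
Proof.
elim/loc_ind=> x; rewrite loc_oppE loc_addE.
by apply: loc_eq; rewrite !fracE; ring.
Qed.

HB.instance Definition _ :=
  GRing.isZmodule.Build localization loc_addA loc_addC loc_add0 loc_addN.

Lemma loc_mulA : associative loc_mul.
Proof.
elim/loc_ind=> x; elim/loc_ind=> y; elim/loc_ind=> z; rewrite !loc_mulE.
by apply: loc_eq; rewrite !fracE; ring.
Qed.

Lemma loc_mulC : commutative loc_mul.
Proof.
elim/loc_ind=> x; elim/loc_ind=> y; rewrite !loc_mulE.
by apply: loc_eq; rewrite !fracE; ring.
Qed.

Lemma loc_mul1 : left_id (loc_of 1) loc_mul.
Proof.
elim/loc_ind=> x; rewrite loc_mulE.
by apply: loc_eq; rewrite !fracE; ring.
Qed.

Lemma loc_mulDl : left_distributive loc_mul loc_add.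
Proof.
elim/loc_ind=> x; elim/loc_ind=> y; elim/loc_ind=> z; rewrite !(loc_addE, loc_mulE).
by apply: loc_eq; rewrite !fracE; ring.
Qed.

Lemma loc_oner_neq0 : loc_of 1 != loc_of 0.
Proof.
apply/eqP => /locP [u [Uu]]; rewrite !fracE !mulr1 subr0 mulr1 => u0.
by have := mset0 U; rewrite -u0 Uu.
Qed.

HB.instance Definition _ := GRing.Zmodule_isComNzRing.Build localization
  loc_mulA loc_mulC loc_mul1 loc_mulDl loc_oner_neq0.

Lemma loc_of_zmod : zmod_morphism loc_of.
Proof.
move=> a b; rewrite -[RHS]/(loc_add _ (loc_opp _)) loc_oppE loc_addE.
by apply: loc_eq; rewrite !fracE; ring.
Qed.

Lemma loc_of_monoid : monoid_morphism loc_of.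
Proof.
split=> // a b; rewrite -[RHS]/(loc_mul _ _) loc_mulE.
by apply: loc_eq; rewrite !fracE; ring.
Qed.

HB.instance Definition _ := GRing.isZmodMorphism.Build R localization loc_of loc_of_zmod.
HB.instance Definition _ := GRing.isMonoidMorphism.Build R localization loc_of loc_of_monoid.

Lemma loc_of_unit s : U s -> exists u, loc_of s * u = 1.
Proof.
move=> Us; exists (loc (mkfrac 1 Us)); rewrite -[LHS]/(loc_mul _ _) loc_mulE.
by apply: loc_eq; rewrite !fracE; ring.
Qed.

Lemma loc_of_surj (p : localization) : exists a s, U s /\ p * loc_of s = loc_of a.
Proof.
elim/loc_ind: p => x; exists (num x), (den x); split; first exact: den_mset.
rewrite -[LHS]/(loc_mul _ _) loc_mulE.
by apply: loc_eq; rewrite !fracE; ring.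
Qed.

Lemma loc_of_eq0 a : loc_of a = 0 -> exists s, U s /\ s * a = 0.
Proof. by move/locP => [u [Uu]]; rewrite !fracE !mulr1 subr0; exists u. Qed.

End Localization.

(** The local hypothesis of the theorem is about any ring satisfying [is_localization]; using it
    takes an actual one. *)
Lemma localization_ex (R : comNzRingType) (m : R -> Prop) : maximal_ideal m ->
  exists (S : comNzRingType) (iota : {rmorphism R -> S}), is_localization m iota.
Proof.
move=> maxm; have [[m0 _ _] m1 _] := maxm.
pose u (s : R) : bool := if excluded_middle_informative (m s) then false else true.
have uP s : reflect (~ m s) (u s).
  by rewrite /u; case: excluded_middle_informative => h; constructor.
have u1 : u 1 by apply/uP.
have uM a b : u a -> u b -> u (a * b).
  by move=> /uP ma /uP mb; apply/uP; apply: maximal_ideal_prime.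
have u0 : ~~ u 0 by apply/negP => /uP.
pose U := Multset u1 uM u0.
exists (localization U : comNzRingType), (loc_of U : {rmorphism _ -> _}); split.
- by move=> s /uP us; apply: (@loc_of_unit R U).
- by move=> x; have [a [s [us e]]] := @loc_of_surj R U x; exists a, s; split=> //; apply/uP.
- by move=> a /loc_of_eq0 [s [us e]]; exists s; split=> //; apply/uP.
Qed.

(** * Dilation *)

Lemma common_multiple (A : comNzRingType) (Sg : A -> Prop) (I : finType)
    (P : I -> A -> Prop) :
  Sg 1 -> (forall a b, Sg a -> Sg b -> Sg (a * b)) ->
  (forall i s r, P i s -> P i (r * s)) -> (forall i, exists s, Sg s /\ P i s) ->
  exists s, Sg s /\ forall i, P i s.
Proof.
move=> Sg1 SgM PM ex.
suff [s [Ss Ps]] : exists s, Sg s /\ forall i, i \in enum I -> P i s.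
  by exists s; split=> // i; apply: Ps; rewrite mem_enum.
elim: (enum I) => [|i r [s [Ss Ps]]]; first by exists 1.
have [s' [Ss' Ps']] := ex i; exists (s * s'); split; first exact: SgM.
move=> i'; rewrite inE => /orP [/eqP ->|/Ps]; first exact: PM.
by rewrite mulrC; apply: PM.
Qed.

Definition const_set (A : comNzRingType) (Sg : A -> Prop) (p : {poly A}) : Prop :=
  exists s, Sg s /\ p = s%:P.

Section PolyDenominators.
Variables (B K : comNzRingType) (j : {rmorphism B -> K}) (Sg : B -> Prop).
Hypothesis Sg1 : Sg 1.
Hypothesis SgM : forall a b, Sg a -> Sg b -> Sg (a * b).

Lemma const_set1 : const_set Sg 1. Proof. by exists 1. Qed.

Lemma const_setM p q : const_set Sg p -> const_set Sg q -> const_set Sg (p * q).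
Proof.
move=> [s [Ss ->]] [s' [Ss' ->]]; exists (s * s').
by rewrite polyCM; split=> //; apply: SgM.
Qed.

Lemma poly_clear : (forall x : K, exists s a, Sg s /\ j s * x = j a) ->
  forall p : {poly K}, exists s a, const_set Sg s /\ map_poly j s * p = map_poly j a.
Proof.
move=> clear; elim/poly_ind => [|p x [_ [a [[s [Ss ->]] e]]]].
  by exists 1, 0; rewrite mulr0 raddf0; split=> //; apply: const_set1.
have [r [b [Sr e']]] := clear x.
exists (r * s)%:P, (r%:P * a * 'X + (s * b)%:P); split.
  by exists (r * s); split=> //; apply: SgM.
rewrite map_polyC /= in e.
rewrite rmorphD !rmorphM /= !map_polyC map_polyX /= -e -e' polyCM mulrDr.
by rewrite !mulrA [(j s)%:P * (j r)%:P]mulrC.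
Qed.

Lemma poly_kill : (forall a, j a = 0 -> exists s, Sg s /\ s * a = 0) ->
  forall p : {poly B}, map_poly j p = 0 -> exists s, const_set Sg s /\ s * p = 0.
Proof.
move=> kill p p0.
have [|i|s [Ss E]] := @common_multiple _ Sg 'I_(size p)
    (fun i s => s * p`_i = 0) Sg1 SgM.
- by move=> i s r e; rewrite -mulrA e mulr0.
- by apply: kill; rewrite -coef_map p0 coef0.
exists s%:P; split; first by exists s.
apply/polyP => i; rewrite coefCM coef0; have [lt|ge] := ltnP i (size p).
  exact: (E (Ordinal lt)).
by rewrite nth_default // mulr0.
Qed.

End PolyDenominators.

(** * Factoring elementary matrices over a polynomial ring *)

Section PolyMatrices.
Variable K : comNzRingType.

Local Notation coef_mx i A := (map_mx (fun p : {poly K} => p`_i) A).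
Local Notation polyC_mx A := (map_mx polyC A).

Lemma coef_mxM_const p q r i (A : 'M[{poly K}]_(p, q)) (D : 'M[K]_(q, r)) :
  coef_mx i (A *m polyC_mx D) = coef_mx i A *m D.
Proof.
apply/matrixP => a b; rewrite !mxE coef_sum; apply: eq_bigr => e _.
by rewrite !mxE coefMC.
Qed.

Lemma coef_polyC_mxM p q r i (D : 'M[K]_(p, q)) (A : 'M[{poly K}]_(q, r)) :
  coef_mx i (polyC_mx D *m A) = D *m coef_mx i A.
Proof.
apply/matrixP => a b; rewrite !mxE coef_sum; apply: eq_bigr => e _.
by rewrite !mxE coefCM.
Qed.

Lemma poly_mx_sum p q (A : 'M[{poly K}]_(p, q)) : exists n,
  A = polyC_mx (coef_mx 0 A) + \sum_(i < n) 'X^(i.+1) *: polyC_mx (coef_mx i.+1 A).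
Proof.
pose n := \max_(ij : 'I_p * 'I_q) size (A ij.1 ij.2); exists n.
have -> : polyC_mx (coef_mx 0 A) + \sum_(i < n) 'X^(i.+1) *: polyC_mx (coef_mx i.+1 A) =
    \sum_(i < n.+1) 'X^i *: polyC_mx (coef_mx i A).
  by rewrite big_ord_recl expr0 scale1r.
apply/matrixP => a b; rewrite summxE.
have le : (size (A a b) <= n.+1)%N.
  by apply/leqW; apply: (leq_bigmax (F := fun ij : 'I_p * 'I_q => size (A ij.1 ij.2)) (a, b)).
rewrite -[LHS](coefK) poly_def (big_ord_widen _ (fun i => (A a b)`_i *: 'X^i) le).
rewrite big_mkcond; apply: eq_bigr => i _; rewrite !mxE.
rewrite -mul_polyC mulrC; case: ifP => // /negbT; rewrite -leqNgt => h.
by rewrite nth_default // mulr0.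
Qed.

Variable m : nat.
Implicit Types (g h N : 'M[K]_m) (A : 'M[{poly K}]_m).

(** Every exponent is positive, so the product is 1 at [X = 0], and scaling [X] by [s] scales each
    constant matrix [N] by a power of [s], which can absorb denominators. *)
Inductive based_unip : 'M[{poly K}]_m -> Prop :=
| based_unip1 : based_unip 1%:M
| based_unipM i N A : unimodular_nilp N -> based_unip A ->
    based_unip ((1%:M + 'X^(i.+1) *: polyC_mx N) *m A).

Lemma based_unip_mul A A' : based_unip A -> based_unip A' -> based_unip (A *m A').
Proof.
move=> bA bA'; elim: bA => [|i N A1 uN _ IH]; first by rewrite mul1mx.
by rewrite -mulmxA; apply: based_unipM.
Qed.

Lemma based_unip_conj A g h : h *m g = 1%:M -> based_unip A ->
  based_unip (polyC_mx g *m A *m polyC_mx h).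
Proof.
move=> hg; have gh := mulmx1C hg.
elim=> [|i N A' uN _ IH].
  by rewrite mulmx1 -map_mxM gh map_mx1; apply: based_unip1.
have -> : polyC_mx g *m ((1%:M + 'X^(i.+1) *: polyC_mx N) *m A') *m polyC_mx h =
    (1%:M + 'X^(i.+1) *: polyC_mx (g *m N *m h)) *m (polyC_mx g *m A' *m polyC_mx h).
  rewrite !mulmxA; congr (_ *m _ *m _).
  rewrite mulmxDr mulmx1 mulmxDl mul1mx !map_mxM; congr (_ + _).
  rewrite -scalemxAr -!scalemxAl -[in RHS]mulmxA -(map_mxM _ h g) hg map_mx1.
  by rewrite mulmx1.
by apply: based_unipM => //; apply: unimodular_nilp_conj.
Qed.

Lemma based_unip_at0 A : based_unip A -> map_mx (horner_eval 0) A = 1%:M.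
Proof.
elim=> [|i N A' _ _ IH]; first by rewrite map_mx1.
rewrite map_mxM IH mulmx1 map_mxD map_mx1 map_mxZ /= {1}/horner_eval hornerXn expr0n /=.
by rewrite scale0r addr0.
Qed.

(** Since products of coefficients vanish, [1 + A] splits into one factor per degree, with the
    constant one placed last. *)
Lemma based_unip_coefs A :
  (forall i, unimodular_nilp (coef_mx i A)) ->
  (forall i k, coef_mx i A *m coef_mx k A = 0) ->
  exists A', based_unip A' /\ 1%:M + A = A' *m polyC_mx (1%:M + coef_mx 0 A).
Proof.
move=> uA AA; have [n AE] := poly_mx_sum A.
set T := \sum_(i < n) _ in AE; exists (1%:M + T); split.
  rewrite /T; clear T AE; elim: n => [|n IH]; first by rewrite big_ord0 addr0; apply: based_unip1.
  set s := (\sum_(i < n) _) in IH.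
  have -> : 1%:M + \sum_(i < n.+1) 'X^(i.+1) *: polyC_mx (coef_mx i.+1 A) =
            (1%:M + 'X^(n.+1) *: polyC_mx (coef_mx n.+1 A)) *m (1%:M + s).
    rewrite big_ord_recr /= -/s mulmxDl mul1mx mulmxDr mulmx1 -scalemxAl.
    have -> : polyC_mx (coef_mx n.+1 A) *m s = 0.
      rewrite mulmx_sumr big1 // => i _.
      by rewrite -scalemxAr -map_mxM AA map_mx0 scaler0.
    by rewrite scaler0 addr0 addrA.
  exact: based_unipM.
rewrite {1}AE map_mxD map_mx1 mulmxDl mul1mx mulmxDr mulmx1.
have -> : T *m polyC_mx (coef_mx 0 A) = 0.
  rewrite mulmx_suml big1 // => i _.
  by rewrite -scalemxAl -map_mxM AA map_mx0 scaler0.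
by rewrite addr0 addrA.
Qed.

Lemma elem_based_unip (c : 'rV[K]_m) (d : 'cV[K]_m) A :
  c *m d = 1%:M -> elem (polyC_mx c) (polyC_mx d) A ->
  exists A' g h, [/\ based_unip A', g *m h = 1%:M & A = A' *m polyC_mx g].
Proof.
move=> cd.
have step A1 A2 : (forall i, unimodular_nilp (coef_mx i A1)) ->
    (forall i k, coef_mx i A1 *m coef_mx k A1 = 0) ->
    (exists A' g h, [/\ based_unip A', g *m h = 1%:M & A2 = A' *m polyC_mx g]) ->
    exists A' g h, [/\ based_unip A', g *m h = 1%:M & (1%:M + A1) *m A2 = A' *m polyC_mx g].
  move=> u1 AA [A' [g [h [bA' gh ->]]]].
  have [A'' [bA'' ->]] := based_unip_coefs u1 AA.
  (* The constant factor [e] is moved to the right past [A'] by conjugation, which preserves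
     [based_unip]. *)
  set e := 1%:M + _; pose e' := 1%:M - coef_mx 0 A1.
  have ee' : e *m e' = 1%:M.
    by rewrite mulmxDl mul1mx mulmxBr mulmx1 AA subr0 subrK.
  exists (A'' *m (polyC_mx e *m A' *m polyC_mx e')), (e *m g), (h *m e'); split.
  - by apply: based_unip_mul => //; apply: based_unip_conj => //; apply: mulmx1C.
  - by rewrite mulmxA -(mulmxA e) gh mulmx1.
  - rewrite map_mxM !mulmxA -(mulmxA _ (polyC_mx e') (polyC_mx e)) -map_mxM.
    by rewrite (mulmx1C ee') map_mx1 mulmx1.
elim=> [|w A2 wd _ IH|u A2 cu _ IH].
- exists 1%:M, 1%:M, 1%:M; rewrite map_mx1 !mulmx1; split=> //; exact: based_unip1.
- have wd0 i : coef_mx i w *m d = 0.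
    by rewrite -coef_mxM_const wd; apply/matrixP => a b; rewrite !mxE coef0.
  apply: step IH => [i|i k]; rewrite !coef_polyC_mxM.
    by exists d, (coef_mx i w); split=> //; left; exists c.
  by rewrite mulmxA -(mulmxA d) wd0 mulmx0 mul0mx.
- have cu0 i : c *m coef_mx i u = 0.
    by rewrite -coef_polyC_mxM cu; apply/matrixP => a b; rewrite !mxE coef0.
  apply: step IH => [i|i k]; rewrite !coef_mxM_const.
    by exists (coef_mx i u), c; split=> //; right; exists d.
  by rewrite mulmxA -(mulmxA (coef_mx i u)) cu0 mulmx0 mul0mx.
Qed.

End PolyMatrices.

Lemma unimodular_nilp_map (S S' : comNzRingType) (f : {rmorphism S -> S'}) m (N : 'M[S]_m) :
  unimodular_nilp N -> unimodular_nilp (map_mx f N).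
Proof.
move=> [x [y [-> yx u]]]; exists (map_mx f x), (map_mx f y); split.
- by rewrite map_mxM.
- by rewrite -map_mxM yx map_mx0.
- case: u => [[p px]|[q yq]]; [left; exists (map_mx f p) | right; exists (map_mx f q)];
  by rewrite -map_mxM ?px ?yq map_mx1.
Qed.

Section Dilation.
Variables (B K : comNzRingType) (j : {rmorphism B -> K}) (Sg : B -> Prop).
Hypothesis Sg1 : Sg 1.
Hypothesis SgM : forall a b, Sg a -> Sg b -> Sg (a * b).
Hypothesis clear : forall x : K, exists s a, Sg s /\ j s * x = j a.
Hypothesis kill : forall a, j a = 0 -> exists s, Sg s /\ s * a = 0.
Variables (m : nat) (c : 'rV[B]_m) (d : 'cV[B]_m).
Hypothesis cd : c *m d = 1%:M.
Variables (i0 : 'I_m) (l : K).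
Hypothesis l_inv : l * j (d i0 0) = 1.
Hypothesis m3 : (2 < m)%N.

Local Notation cP := (map_mx polyC c).
Local Notation dP := (map_mx polyC d).
Local Notation dil s := (comp_poly (s%:P * 'X)).
Local Notation f := (map_poly j).

Let cPdP : cP *m dP = 1%:M. Proof. by rewrite -map_mxM cd map_mx1. Qed.

Lemma based_unip_lift A : based_unip A -> exists s, Sg s /\ forall r,
  exists2 h, elem cP dP h & map_mx f h = map_mx (dil (j (s * r))) A.
Proof.
elim=> [|i N A' uN _ [s2 [S2 H2]]].
  exists 1; split=> // r; exists 1%:M; first exact: elem1.
  by rewrite !map_mx1.
have clearP := poly_clear Sg1 SgM clear.
have lP : l%:P * f (dP i0 0) = 1 by rewrite mxE map_polyC /= -polyCM l_inv.
have [p [[s1 [S1 ->]] H1]] := liftable_unimodular_nilp (const_set1 Sg1)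
  (const_setM SgM) clearP cPdP lP m3 (unimodular_nilp_map polyC uN).
exists (s1 * s2); split=> [|r]; first exact: SgM.
(* Liftability supplies one factor [s1]; with the [s1 ^+ i] placed in the multiplier, this is the
   power [i.+1] produced by the substitution in ['X^(i.+1)]. *)
have [h1 E1 h1E] := H1 ((s1 ^+ i * (s2 * r) ^+ i.+1)%:P * 'X^(i.+1)).
have [h2 E2 h2E] := H2 (s1 * r).
exists (h1 *m h2); first exact: elemM.
have -> : s1 * s2 * r = s2 * (s1 * r) by rewrite mulrCA mulrA.
rewrite !map_mxM h1E h2E; congr (_ *m _).
rewrite map_mxD map_mx1 map_mxZ -map_mx_comp; congr (_ + _ *: _).
  have -> : s1%:P * ((s1 ^+ i * (s2 * r) ^+ i.+1)%:P * 'X^(i.+1)) =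
            ((s2 * (s1 * r)) ^+ i.+1)%:P * 'X^(i.+1).
    by rewrite (mulrA s1%:P) -polyCM (mulrA s1) -exprS -exprMn (mulrCA s1).
  rewrite /= comp_Xn_poly [in RHS]exprMn [in LHS]rmorphM /= map_polyC map_polyXn /=.
  by rewrite rmorphXn /= polyC_exp.
by apply/matrixP => a b; rewrite !mxE /= comp_polyC.
Qed.

Lemma kill_mx (D : 'M[{poly B}]_m) : map_mx f D = 0 ->
  exists s, Sg s /\ s%:P *: D = 0.
Proof.
move=> D0; have killP := poly_kill Sg1 SgM kill.
have [|ab|p [[s [Ss ->]] E]] := @common_multiple _ (const_set Sg) ('I_m * 'I_m)%type
    (fun ab p => p * D ab.1 ab.2 = 0) (const_set1 Sg1) (const_setM SgM).
- by move=> i s r e; rewrite -mulrA e mulr0.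
- by apply: killP; have := congr1 (fun A : 'M_m => A ab.1 ab.2) D0; rewrite !mxE.
exists s; split=> //; apply/matrixP => a b; rewrite !mxE; exact: (E (a, b)).
Qed.

(** One substitution clears the denominators of a factorization over [K]; a second one removes the
    discrepancy between the lift and [eta], which is invisible over [K]. *)
Lemma dilation (eta : 'M[{poly B}]_m) :
  map_mx (horner_eval 0) eta = 1%:M ->
  elem (map_mx f cP) (map_mx f dP) (map_mx f eta) ->
  exists s, Sg s /\ elem cP dP (map_mx (dil s) eta).
Proof.
move=> eta0 Eeta.
have fC p q (A : 'M[B]_(p, q)) : map_mx f (map_mx polyC A) = map_mx polyC (map_mx j A).
  by apply/matrixP => a b; rewrite !mxE map_polyC.
have cdK : map_mx j c *m map_mx j d = 1%:M by rewrite -map_mxM cd map_mx1.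
rewrite !fC in Eeta; have [A [g [g' [bA gg' etaE]]]] := elem_based_unip cdK Eeta.
have f0 p q (D : 'M[{poly B}]_(p, q)) :
    map_mx (horner_eval 0) (map_mx f D) = map_mx j (map_mx (horner_eval 0) D).
  by apply/matrixP => a b; rewrite !mxE /horner_eval -[0]/(0 : K) -(rmorph0 j) horner_map.
(* At 0 both [eta] and [A] become 1, hence so does the constant factor. *)
have g1 : g = 1%:M.
  have := congr1 (map_mx (horner_eval 0)) etaE.
  rewrite f0 eta0 map_mx1 map_mxM (based_unip_at0 bA) mul1mx -map_mx_comp.
  by move->; apply/matrixP => a b; rewrite !mxE /= /horner_eval hornerC.
rewrite g1 map_mx1 mulmx1 in etaE.
have [s [Ss Hs]] := based_unip_lift bA; have [h Eh hE] := Hs 1.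
rewrite mulr1 in hE.
(* The value of [h] at 0 is known to be 1 over [K] only. Multiplying by its inverse [k] makes it 1
   over [B] without changing the image over [K]. *)
have Eh0 : elem cP dP (map_mx (polyC \o horner_eval 0) h).
  have e p q (D : 'M[B]_(p, q)) : map_mx (polyC \o horner_eval 0) (map_mx polyC D) = map_mx polyC D.
    by apply/matrixP => a b; rewrite !mxE /= /horner_eval hornerC.
  by rewrite -(e _ _ c) -(e _ _ d); apply: elem_map.
have [k Ek hk] := elem_inv_ex Eh0.
have etas0 : map_mx (horner_eval 0) (map_mx (dil s) eta) = 1%:M.
  rewrite -eta0; apply/matrixP => a b; rewrite !mxE /horner_eval.
  by rewrite horner_comp hornerM hornerX mulr0.
have feta : map_mx f (map_mx (dil s) eta) = map_mx f h.
  rewrite hE -etaE; apply/matrixP => a b; rewrite !mxE map_comp_poly rmorphM /=.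
  by rewrite map_polyC map_polyX.
have fh0 : map_mx j (map_mx (horner_eval 0) h) = 1%:M.
  by rewrite -f0 -feta f0 etas0 map_mx1.
have fk : map_mx f k = 1%:M.
  have := congr1 (map_mx f) hk; rewrite map_mxM map_mx1 map_mx_comp fC fh0 map_mx1.
  by rewrite mul1mx.
have k0 : map_mx (horner_eval 0) (h *m k) = 1%:M.
  have := congr1 (map_mx (horner_eval 0)) hk; rewrite !map_mxM map_mx1 => <-.
  by congr (_ *m _); apply/matrixP => a b; rewrite !mxE /= /horner_eval hornerC.
have [D DE] : exists D, D = map_mx (dil s) eta - h *m k by exists (map_mx (dil s) eta - h *m k).
have D0 : map_mx f D = 0 by rewrite DE map_mxB feta map_mxM fk mulmx1 subrr.
have Dat0 : map_mx (horner_eval 0) D = 0 by rewrite DE map_mxB etas0 k0 subrr.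
have [s' [Ss' sD]] := kill_mx D0.
exists (s * s'); split; first exact: SgM.
(* [D] has no constant term, and [X := s' X] multiplies its other coefficients by powers of [s'],
   which kill them. *)
have dD : map_mx (dil s') D = 0.
  apply/matrixP => a b; rewrite !mxE.
  have h0 : (D a b).[0] = 0 by have := congr1 (fun A : 'M_m => A a b) Dat0; rewrite !mxE.
  have hs : s'%:P * D a b = 0 by have := congr1 (fun A : 'M_m => A a b) sD; rewrite !mxE.
  move: (D a b) h0 hs => p p0 sp.
  rewrite comp_polyE big1 // => i _; case: (nat_of_ord i) => [|n].
    by rewrite -(horner_coef0 p) p0 scale0r.
  rewrite exprMn -mul_polyC mulrA exprS mulrA [_ * s'%:P]mulrC -polyCM.
  by have := congr1 (fun q : {poly B} => q`_n.+1) sp; rewrite coefCM coef0 => ->; rewrite !mul0r.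
have -> : map_mx (dil (s * s')) eta = map_mx (dil s') (h *m k).
  have -> : map_mx (dil s') (h *m k) = map_mx (dil s') (map_mx (dil s) eta).
    by apply/eqP; rewrite eq_sym -subr_eq0 -map_mxB -DE dD.
  have e1 : (s%:P * 'X) \Po (s'%:P * 'X) = (s * s')%:P * 'X.
    by rewrite comp_polyM comp_polyC comp_polyX polyCM mulrA.
  by apply/matrixP => a b; rewrite !mxE /= -comp_polyA e1.
have e p q (A0 : 'M[B]_(p, q)) : map_mx (dil s') (map_mx polyC A0) = map_mx polyC A0.
  by apply/matrixP => a b; rewrite !mxE /= comp_polyC.
by rewrite -(e _ _ c) -(e _ _ d); apply: elem_map; apply: elemM.
Qed.

End Dilation.

(** * Substitutions in iterated polynomial rings *)

Fixpoint mconst_hom (R : comNzRingType) (t : nat) : {rmorphism R -> mpoly R t} :=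
  match t return {rmorphism R -> mpoly R t} with
  | 0 => idfun
  | t'.+1 => (polyC \o mconst_hom R t' : {rmorphism R -> {poly mpoly R t'}})
  end.

Lemma mconst_homE (R : comNzRingType) t : mconst_hom R t =1 @mconst R t.
Proof. by elim: t => [|t IH] r //=; rewrite IH. Qed.

Fixpoint mmap_hom (R S : comNzRingType) (f : {rmorphism R -> S}) (t : nat) :
    {rmorphism mpoly R t -> mpoly S t} :=
  match t return {rmorphism mpoly R t -> mpoly S t} with
  | 0 => f
  | t'.+1 => (map_poly (mmap_hom f t') :
      {rmorphism {poly mpoly R t'} -> {poly mpoly S t'}})
  end.

Lemma mmap_homE (R S : comNzRingType) (f : {rmorphism R -> S}) t : mmap_hom f t =1 @mmap R S f t.
Proof. by elim: t => [|t IH] p //=; apply: eq_map_poly. Qed.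

(** The last variable is the outermost one; indices beyond the range give 0. *)
Fixpoint mvar (R : comNzRingType) (t i : nat) : mpoly R t :=
  match t return mpoly R t with
  | 0 => 0
  | t'.+1 => if i == t' then 'X else (mvar R t' i)%:P
  end.

(** Reduces identities between substitutions to constants and variables. *)
Lemma mpoly_hom_ext (R L : comNzRingType) t (h1 h2 : {rmorphism mpoly R t -> L}) :
  (forall r, h1 (mconst t r) = h2 (mconst t r)) ->
  (forall i, (i < t)%N -> h1 (mvar R t i) = h2 (mvar R t i)) -> h1 =1 h2.
Proof.
elim: t h1 h2 => [|t IH] h1 h2 eC eX p; first exact: eC.
have e a : h1 a%:P = h2 a%:P.
  apply: (IH (h1 \o polyC) (h2 \o polyC)) => [r|i it]; first exact: eC.
  by have := eX i (leqW it); rewrite /= (ltn_eqF it).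
have eX' : h1 'X = h2 'X by have := eX t (ltnSn t); rewrite /= eqxx.
elim/poly_ind: p => [|p a IHp]; first by rewrite !rmorph0.
by rewrite !rmorphD !rmorphM /= IHp eX' e.
Qed.

Fixpoint mev (R L : comNzRingType) (f : {rmorphism R -> L}) (v : nat -> L) (t : nat) :
    {rmorphism mpoly R t -> L} :=
  match t return {rmorphism mpoly R t -> L} with
  | 0 => f
  | t'.+1 => (horner_morph (fun x => mulrC (v t') (mev f v t' x)) :
      {rmorphism {poly mpoly R t'} -> L})
  end.

Lemma mev_const (R L : comNzRingType) (f : {rmorphism R -> L}) v t r :
  mev f v t (mconst t r) = f r.
Proof. by elim: t => //= t IH; rewrite horner_morphC. Qed.

Lemma mev_var (R L : comNzRingType) (f : {rmorphism R -> L}) v t i :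
  (i < t)%N -> mev f v t (mvar R t i) = v i.
Proof.
elim: t => //= t IH; rewrite ltnS leq_eqVlt; case: eqVneq => [->|_] /=.
  by rewrite horner_morphX.
by move/IH; rewrite horner_morphC.
Qed.

(* [mscale e r] is the substitution [X_i := r X_i], composed with [e]. *)
Section Scaling.
Variables (R : comNzRingType) (t : nat).

Definition mscale (L : comNzRingType) (e : {rmorphism mpoly R t -> L}) (r : L) :
    {rmorphism mpoly R t -> L} :=
  mev (e \o mconst_hom R t) (fun i => r * e (mvar R t i)) t.

Lemma mscale_const (L : comNzRingType) (e : {rmorphism mpoly R t -> L}) r a :
  mscale e r (mconst t a) = e (mconst t a).
Proof. by rewrite mev_const /= mconst_homE. Qed.

Lemma mscale_var (L : comNzRingType) (e : {rmorphism mpoly R t -> L}) r i : (i < t)%N ->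
  mscale e r (mvar R t i) = r * e (mvar R t i).
Proof. exact: mev_var. Qed.

Lemma mscale_comp (L L' : comNzRingType) (e : {rmorphism mpoly R t -> L}) (e' : {rmorphism mpoly R t -> L'})
    (h : {rmorphism L -> L'}) r :
  h \o e =1 e' -> h \o mscale e r =1 mscale e' (h r).
Proof.
move=> he; apply: (@mpoly_hom_ext _ _ _ (h \o mscale e r)) => [a|i it] /=.
  by rewrite !mscale_const -he.
by rewrite !mscale_var // rmorphM -he.
Qed.

Lemma mscale1 (L : comNzRingType) (e : {rmorphism mpoly R t -> L}) : mscale e 1 =1 e.
Proof.
by apply: mpoly_hom_ext => [a|i it]; rewrite ?mscale_const // mscale_var // mul1r.
Qed.

Lemma meval0_homE : mev idfun (fun=> 0) t =1 @meval0 R t.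
Proof.
elim: t => [|t' IH] p //=; rewrite /horner_morph -IH.
rewrite -[X in _.[X]](rmorph0 (mev idfun (fun=> 0) t')) horner_map.
by [].
Qed.

Lemma mscale0 (L : comNzRingType) (e : {rmorphism mpoly R t -> L}) p :
  mscale e 0 p = e (mconst t (meval0 p)).
Proof.
rewrite -mconst_homE -meval0_homE.
apply: (@mpoly_hom_ext _ _ _ _ (e \o mconst_hom R t \o mev idfun (fun=> 0) t)) => [a|i it] /=.
  by rewrite mscale_const mev_const mconst_homE.
by rewrite mscale_var // mev_var // !rmorph0 mul0r.
Qed.

End Scaling.

Lemma mmap_const (R S : comNzRingType) (f : {rmorphism R -> S}) t r :
  mmap_hom f t (mconst t r) = mconst t (f r).
Proof. by elim: t => //= t IH; rewrite map_polyC /= IH. Qed.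

Lemma mmap_var (R S : comNzRingType) (f : {rmorphism R -> S}) t i :
  mmap_hom f t (mvar R t i) = mvar S t i.
Proof.
elim: t => [|t IH] /=; first by rewrite rmorph0.
by case: eqP => _; rewrite ?map_polyX // map_polyC /= IH.
Qed.

Lemma mscale_mmap (R S L : comNzRingType) (f : {rmorphism R -> S}) t
    (e : {rmorphism mpoly S t -> L}) r :
  mscale (e \o mmap_hom f t) r =1 mscale e r \o mmap_hom f t.
Proof.
apply: (@mpoly_hom_ext _ _ _ _ (mscale e r \o mmap_hom f t)) => [a|i it] /=.
  by rewrite mscale_const /= mmap_const mscale_const.
by rewrite mscale_var //= mmap_var mscale_var.
Qed.

Definition away (R : comNzRingType) (m : R -> Prop) t (p : mpoly R t) : Prop :=
  exists s, ~ m s /\ p = mconst t s.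

Lemma away1 (R : comNzRingType) m t : ~ m 1 -> @away R m t 1.
Proof. by move=> m1; exists 1; rewrite -mconst_homE rmorph1. Qed.

Lemma awayM (R : comNzRingType) m t a b : maximal_ideal m -> @away R m t a -> away m b -> away m (a * b).
Proof.
move=> maxm [s [ms ->]] [s' [ms' ->]]; exists (s * s'); split.
  exact: maximal_ideal_prime.
by rewrite -!mconst_homE rmorphM.
Qed.

Section LocalDenominators.
Variables (R S : comNzRingType) (m : R -> Prop) (iota : {rmorphism R -> S}).
Hypothesis maxm : maximal_ideal m.
Hypothesis locm : is_localization m iota.

Let m1 : ~ m 1. Proof. by case: maxm. Qed.

Lemma mpoly_clear t (x : mpoly S t) :
  exists s a, away m s /\ mmap_hom iota t s * x = mmap_hom iota t a.
Proof.
elim: t x => [|t IH] x /=.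
  case: locm => _ surj _; have [a [s [ms e]]] := surj x.
  by exists s, a; split; [exists s | rewrite mulrC].
have [s [a [[s' [[r [mr ->]] ->]] e]]] :=
  poly_clear (away1 t m1) (fun a b => @awayM _ _ _ a b maxm) IH x.
by exists (mconst t r)%:P, a; split=> //; exists r.
Qed.

Lemma mpoly_kill t (a : mpoly R t) : mmap_hom iota t a = 0 ->
  exists s, away m s /\ s * a = 0.
Proof.
elim: t a => [|t IH] a /= a0.
  case: locm => _ _ ker; have [s [ms e]] := ker a a0.
  by exists s; split=> //; exists s.
have [s [[s' [[r [mr ->]] ->]] e]] :=
  poly_kill (away1 t m1) (fun a b => @awayM _ _ _ a b maxm) IH a0.
by exists (mconst t r)%:P; split=> //; exists r.
Qed.
End LocalDenominators.

(** * Patching *)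

Lemma bivariate_eval (A L : comNzRingType) (e : {rmorphism A -> L}) (y z : L) :
  exists h : {rmorphism {poly {poly A}} -> L},
    [/\ forall a, h a%:P%:P = e a, h 'X%:P = y & h 'X = z].
Proof.
pose h1 : {rmorphism {poly A} -> L} := horner_morph (fun a => mulrC y (e a)).
exists (horner_morph (fun q => mulrC z (h1 q)) : {rmorphism _ -> _}).
by split=> [a||] /=; rewrite ?horner_morphC ?horner_morphX //= ?horner_morphC ?horner_morphX.
Qed.

Section Patching.
Variables (R : comNzRingType) (t k : nat) (c : 'rV[R]_k) (d : 'cV[R]_k).
Variables theta theta' : 'M[mpoly R t]_k.
Hypothesis cd : c *m d = 1%:M.
Hypothesis theta_inv : theta *m theta' = 1%:M.

Local Notation A := (mpoly R t).
Local Notation C := {poly {poly A}}.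
Local Notation Y := ('X%:P : C).
Local Notation Z := ('X : C).
Let e2 : {rmorphism A -> C} := polyC \o polyC.
Let sc (s : R) : C := e2 (mconst t s).
Let cC := map_mx (fun r => e2 (mconst t r)) c.
Let dC := map_mx (fun r => e2 (mconst t r)) d.
(* [theta(y X) theta(z X)^-1] *)
Let ratio (y z : C) := map_mx (mscale e2 y) theta *m map_mx (mscale e2 z) theta'.

(** This telescoping makes [patch_set] closed under addition. *)
Let ratioK y z w : ratio y z *m ratio z w = ratio y w.
Proof.
rewrite /ratio mulmxA -(mulmxA _ _ (map_mx (mscale e2 z) theta)) -map_mxM.
by rewrite (mulmx1C theta_inv) map_mx1 mulmx1.
Qed.

Let ratio_sub (h : {rmorphism C -> C}) y z : h \o e2 =1 e2 ->
  map_mx h (ratio y z) = ratio (h y) (h z).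
Proof.
move=> he; rewrite map_mxM -!map_mx_comp; congr (_ *m _); apply: eq_map_mx;
exact: mscale_comp.
Qed.

Let elem_sub (h : {rmorphism C -> C}) g : h \o e2 =1 e2 ->
  elem cC dC g -> elem cC dC (map_mx h g).
Proof.
move=> he Eg.
have hc p q (M : 'M[R]_(p, q)) : map_mx (fun r => e2 (mconst t r)) M =
    map_mx h (map_mx (fun r => e2 (mconst t r)) M).
  by rewrite -map_mx_comp; apply: eq_map_mx => r /=; rewrite -[LHS]he.
by rewrite /cC /dC (hc _ _ c) (hc _ _ d); apply: elem_map.
Qed.

Definition patch_set (s : R) : Prop := elem cC dC (ratio (Y + sc s * Z) Y).

Lemma patch_ideal : ideal patch_set.
Proof.
have scD a b : sc (a + b) = sc a + sc b.
  by rewrite /sc -!mconst_homE !rmorphD.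
have scM a b : sc (a * b) = sc a * sc b.
  by rewrite /sc -!mconst_homE !rmorphM.
split.
- rewrite /patch_set (_ : sc 0 = 0) ?mul0r ?addr0; last first.
    by rewrite /sc -mconst_homE !rmorph0.
  by rewrite /ratio -map_mxM theta_inv map_mx1; apply: elem1.
(* Substituting [Y := Y + a Z] in the matrix of [b] gives the left factor of the telescoping
   product. *)
- move=> a b Ja Jb; have [h [he hY hZ]] := bivariate_eval e2 (Y + sc a * Z) Z.
  have := elem_sub he Jb; rewrite ratio_sub // rmorphD rmorphM hY hZ he => E.
  rewrite /patch_set scD mulrDl addrA -(ratioK _ (Y + sc a * Z)).
  exact: elemM.
(* Here the substitution is [Z := r Z]. *)
- move=> r a Ja; have [h [he hY hZ]] := bivariate_eval e2 Y (sc r * Z).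
  have := elem_sub he Ja; rewrite ratio_sub // rmorphD rmorphM hY hZ he.
  by rewrite /patch_set scM mulrA [sc r * _]mulrC.
Qed.

Lemma patch_total : map_mx (@meval0 R t) theta = 1%:M -> patch_set 1 ->
  elem (map_mx (@mconst R t) c) (map_mx (@mconst R t) d) theta.
Proof.
move=> theta0 J1; have [h [he hY hZ]] := bivariate_eval (idfun : {rmorphism A -> A}) 0 1.
have he' : h \o e2 =1 (idfun : {rmorphism A -> A}) := he.
have := elem_map h J1.
have hc p q (M : 'M[R]_(p, q)) :
    map_mx h (map_mx (fun r => e2 (mconst t r)) M) = map_mx (@mconst R t) M.
  by rewrite -map_mx_comp; apply: eq_map_mx => r /=; rewrite he.
rewrite !hc map_mxM -!map_mx_comp.
have theta'0 : map_mx (mev idfun (fun=> 0) t) theta' = 1%:M.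
  have := congr1 (map_mx (mev (idfun : {rmorphism R -> R}) (fun=> 0) t)) theta_inv.
  rewrite map_mxM map_mx1.
  by rewrite (eq_map_mx _ (@meval0_homE R t)) theta0 mul1mx.
have -> : map_mx (h \o mscale e2 (Y + sc 1 * Z)) theta = theta.
  have h1 : h (Y + sc 1 * Z) = 1.
    rewrite rmorphD rmorphM hY hZ he add0r mulr1 /=.
    by rewrite -mconst_homE rmorph1.
  by apply: map_mx_id => p; rewrite (mscale_comp _ he') h1 mscale1.
(* At [Y = 0] the second factor is the value of [theta'] at the origin, the inverse of that of
   [theta]. *)
have -> : map_mx (h \o mscale e2 Y) theta' = 1%:M.
  rewrite (eq_map_mx _ (mscale_comp _ he')) hY.
  have /eq_map_mx -> : mscale idfun 0 =1 mconst_hom R t \o mev idfun (fun=> 0) t.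
    by move=> p; rewrite mscale0 /= meval0_homE mconst_homE.
  by rewrite map_mx_comp theta'0 map_mx1.
by rewrite mulmx1.
Qed.

(** Dilation is applied in the variable [Z], with coefficients in [{poly A}], that is, in
    [mpoly R t.+1] with [Y] as its last variable. *)
Lemma patch_local (m : R -> Prop) (S : comNzRingType) (iota : {rmorphism R -> S}) :
  (2 < k)%N -> maximal_ideal m -> is_localization m iota ->
  elem (map_mx (fun r => mconst t (iota r)) c) (map_mx (fun r => mconst t (iota r)) d)
    (map_mx (mmap_hom iota t) theta) ->
  exists s, ~ m s /\ patch_set s.
Proof.
move=> k3 maxm locm Eth; have [[m0 mD mM] m1 _] := maxm.
(* Otherwise [c d = 1] would put 1 into [m]. *)
have [i0 mi0] : exists i, ~ m (d i 0).
  apply: NNPP => none; apply: m1.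
  have <- : \sum_i c 0 i * d i 0 = 1.
    by have := congr1 (fun M : 'M_1 => M 0 0) cd; rewrite !mxE.
  apply: big_ind => // i _; apply: mM; apply: NNPP => mi; apply: none; by exists i.
have [u ue] : exists u, iota (d i0 0) * u = 1 by case: locm => h _ _; apply: h.
pose cB := map_mx (@mconst R t.+1) c; pose dB := map_mx (@mconst R t.+1) d.
have cdB : cB *m dB = 1%:M.
  by rewrite /cB /dB -!(eq_map_mx _ (@mconst_homE R t.+1)) -map_mxM cd map_mx1.
have u_inv : mconst t.+1 u * mmap_hom iota t.+1 (dB i0 0) = 1.
  by rewrite mxE mmap_const -!mconst_homE -rmorphM mulrC ue rmorph1.
pose eta := ratio (Y + Z) Y.
have eta0 : map_mx (horner_eval 0) eta = 1%:M.
  have he : horner_eval (0 : {poly A}) \o e2 =1 polyC.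
    by move=> p; rewrite /= /horner_eval hornerC.
  rewrite map_mxM -!map_mx_comp !(eq_map_mx _ (mscale_comp _ he)) /=.
  by rewrite /horner_eval hornerD hornerC hornerX addr0 -map_mxM theta_inv map_mx1.
pose F : {rmorphism C -> {poly {poly mpoly S t}}} := map_poly (mmap_hom iota t.+1).
pose e2S : {rmorphism mpoly S t -> {poly {poly mpoly S t}}} := polyC \o polyC.
have Fe : F \o e2 =1 e2S \o mmap_hom iota t.
  by move=> p; rewrite /= map_polyC /= map_polyC.
have Fc p q (M : 'M[R]_(p, q)) : map_mx F (map_mx polyC (map_mx (@mconst R t.+1) M)) =
    map_mx (fun r => e2S (mconst t (iota r))) M.
  rewrite -!map_mx_comp; apply: eq_map_mx => r.
  by rewrite -[LHS]/((F \o e2) (mconst t r)) Fe /= mmap_const.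
have Er r : elem (map_mx (fun r => e2S (mconst t (iota r))) c)
    (map_mx (fun r => e2S (mconst t (iota r))) d)
    (map_mx (mscale e2S (F r)) (map_mx (mmap_hom iota t) theta)).
  have hc p q (M : 'M[R]_(p, q)) : map_mx (fun r => e2S (mconst t (iota r))) M =
      map_mx (mscale e2S (F r)) (map_mx (fun r => mconst t (iota r)) M).
    by rewrite -map_mx_comp; apply: eq_map_mx => a /=; rewrite mscale_const.
  by rewrite (hc _ _ c) (hc _ _ d); apply: elem_map.
have Fk r M : map_mx F (map_mx (mscale e2 r) M) =
    map_mx (mscale e2S (F r)) (map_mx (mmap_hom iota t) M) :> 'M_k.
  rewrite -!map_mx_comp; apply: eq_map_mx => p.
  by rewrite (mscale_comp _ Fe) mscale_mmap.
(* Both factors of [eta] come from the locally elementary [theta] by substitution, the second one up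
   to inversion. *)
have Eeta : elem (map_mx F (map_mx polyC cB)) (map_mx F (map_mx polyC dB)) (map_mx F eta).
  rewrite !Fc map_mxM !Fk; apply: elemM; first exact: Er.
  apply: (elem_inv (Er Y)); rewrite -!map_mxM theta_inv !map_mx1 //.
have [s [[s0 [ms0 sE]] Es]] := dilation (away1 t.+1 m1)
   (fun a b => @awayM _ _ _ a b maxm) (mpoly_clear maxm locm (t := t.+1))
   (mpoly_kill maxm locm (t := t.+1)) cdB u_inv k3 eta0 Eeta.
exists s0; split=> //; rewrite /patch_set.
have he : comp_poly (s%:P * 'X) \o e2 =1 e2 by move=> p; rewrite /= comp_polyC.
have -> : ratio (Y + sc s0 * Z) Y = map_mx (comp_poly (s%:P * 'X)) eta.
  rewrite ratio_sub // rmorphD /= comp_polyC comp_polyX.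
  by rewrite sE.
have cE p q (M : 'M[R]_(p, q)) : map_mx (fun r => e2 (mconst t r)) M =
   map_mx polyC (map_mx (@mconst R t.+1) M) by rewrite -map_mx_comp.
by rewrite /cC /dC !cE.
Qed.

End Patching.

(** * Vaserstein's groups as elementary groups of unimodular pairs *)

Section VasersteinGroup.
Variables (S : comNzRingType) (k : nat) (phi : 'M[S]_(1 + k)).
Hypothesis alt_phi : alternating phi.
Hypothesis unit_phi : exists W, phi *m W = 1%:M.

Local Notation c := (phi_c phi).
Local Notation d := (phi_d phi).
Local Notation nu := (phi_nu phi).
Local Notation mu := (phi_mu phi).

Lemma minv_mul : minv phi *m phi = 1%:M.
Proof.
rewrite /minv; apply: (@epsilon_spec _ _ (fun psi => psi *m phi = 1%:M)).
by have [W /mulmx1C] := unit_phi; exists W.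
Qed.

Let alt_block (B : 'M[S]_(1 + k)) : alternating B ->
  B = block_mx 0 (ursubmx B) (- (ursubmx B)^T) (drsubmx B).
Proof.
move=> [N BE]; rewrite -[LHS]submxK; congr block_mx.
  by apply/matrixP => i l; rewrite BE !mxE !ord1 subrr.
by apply/matrixP => i l; rewrite BE !mxE opprB.
Qed.

(** With [psi] the inverse, [psi = psi phi psi = - psi phi psi^T], and [phi = N - N^T] then exhibits
    the required form. Antisymmetry alone would not give a zero diagonal in characteristic 2. *)
Let alt_minv : alternating (minv phi).
Proof.
have [N phiE] := alt_phi; set psi := minv phi.
have phiT : phi^T = - phi by rewrite phiE linearB /= trmxK opprB.
have psiT : psi^T = - psi.
  have e : (- psi^T) *m phi = 1%:M.
    by rewrite mulNmx -mulmxN -phiT -trmx_mul (mulmx1C minv_mul) trmx1.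
  have e' : - psi^T = psi by rewrite -[LHS]mulmx1 -(mulmx1C minv_mul) mulmxA e mul1mx.
  by rewrite -[in RHS]e' opprK.
exists (- (psi *m N *m psi^T)).
have -> : (- (psi *m N *m psi^T))^T = - (psi *m N^T *m psi^T).
  by rewrite linearN /= !trmx_mul trmxK mulmxA.
by rewrite psiT !mulmxN !opprK -mulmxBl -mulmxBr -phiE minv_mul mul1mx.
Qed.

Lemma vaserstein_blocks :
  [/\ c *m d^T = 1%:M, c *m mu = 0, nu *m d^T = 0 & d^T *m c + mu *m nu = 1%:M].
Proof.
have psi_phi := minv_mul; have phi_psi := mulmx1C psi_phi.
have phiE : phi = block_mx 0 (- c) c^T nu.
  by rewrite /phi_c opprK linearN /=; apply: alt_block.
have psiE : minv phi = block_mx 0 d (- d^T) mu by apply: alt_block.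
have : block_mx 0 d (- d^T) mu *m block_mx 0 (- c) c^T nu = 1%:M by rewrite -phiE -psiE.
have : block_mx 0 (- c) c^T nu *m block_mx 0 d (- d^T) mu = 1%:M by rewrite -phiE -psiE.
rewrite !mulmx_block (scalar_mx_block 1 k).
move=> /eq_block_mx [e2 e3 e4 _] /eq_block_mx [_ _ _ e1]; split.
- by rewrite -e2 mul0mx add0r mulNmx mulmxN opprK.
- by move: e3; rewrite mul0mx add0r mulNmx => /eqP; rewrite oppr_eq0 => /eqP.
- by move: e4; rewrite mulmx0 add0r mulmxN => /eqP; rewrite oppr_eq0 => /eqP.
- by rewrite -e1 mulNmx mulmxN opprK.
Qed.

Lemma in_Ephi_elem g : in_Ephi phi g <-> elem c d^T g.
Proof.
have [cd cmu nud id] := vaserstein_blocks; split.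
- elim=> [|v|v|g1 g2 _ E1 _ E2|g1 h _ E1 gh _].
  + exact: elem1.
  + by rewrite /alpha_phi -mulmxA; apply: elem_row; rewrite -mulmxA nud mulmx0.
  + by rewrite /beta_phi; apply: elem_col; rewrite mulmxA cmu mul0mx.
  + exact: elemM.
  + exact: elem_inv gh.
- elim=> [|w g1 wd _ IH|u g1 cu _ IH]; first exact: in_Ephi1.
  + apply: in_Ephi_mul => //.
    (* Multiplying [w] by [d^T c + mu nu = 1] and using [w d^T = 0] gives the argument of
       [alpha_phi]. *)
    have -> : w = (w *m mu) *m nu.
      by rewrite -[LHS]mulmx1 -id mulmxDr mulmxA wd mul0mx add0r mulmxA.
    by rewrite mulmxA; apply: in_Ephi_alpha.
  + apply: in_Ephi_mul => //.
    (* Dually, [c u = 0] gives [u = mu nu u]. *)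
    have -> : u = mu *m (nu *m u)^T^T.
      by rewrite trmxK -[LHS]mul1mx -id mulmxDl -mulmxA cu mulmx0 add0r mulmxA.
    exact: in_Ephi_beta.
Qed.

End VasersteinGroup.

Lemma in_Ephi_map (R S : comNzRingType) (f : {rmorphism R -> S}) k
    (phi : 'M[R]_(1 + k)) g :
  alternating phi -> (exists W, phi *m W = 1%:M) ->
  in_Ephi (map_mx f phi) g <->
  elem (map_mx f (phi_c phi)) (map_mx f (phi_d phi)^T) g.
Proof.
move=> alt_phi unit_phi.
have alt_f : alternating (map_mx f phi).
  by have [N ->] := alt_phi; exists (map_mx f N); rewrite map_mxB map_trmx.
have unit_f : exists W, map_mx f phi *m W = 1%:M.
  by have [W e] := unit_phi; exists (map_mx f W); rewrite -map_mxM e map_mx1.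
(* Although [minv] is a choice, inverses are unique, so it commutes with [f]. *)
have minvE : minv (map_mx f phi) = map_mx f (minv phi).
  have e : map_mx f (minv phi) *m map_mx f phi = 1%:M.
    by rewrite -map_mxM minv_mul // map_mx1.
  by rewrite -[LHS]mulmx1 -(mulmx1C e) mulmxA minv_mul // mul1mx.
have -> : map_mx f (phi_c phi) = phi_c (map_mx f phi).
  by apply/matrixP => i j; rewrite !mxE rmorphN.
have -> : map_mx f (phi_d phi)^T = (phi_d (map_mx f phi))^T.
  by rewrite /phi_d minvE; apply/matrixP => i j; rewrite !mxE.
exact: in_Ephi_elem.
Qed.

Theorem theorem4p7 (R : comNzRingType) (n t : nat)
    (phi : 'M[R]_(1 + (n.*2).-1)) (theta : 'M[mpoly R t]_((n.*2).-1)) :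
  (2 <= n)%N -> (1 <= t)%N ->
  alternating phi -> pfaffian phi = 1 ->
  \det theta = 1 -> map_mx (@meval0 R t) theta = 1%:M ->
  (forall m : R -> Prop, maximal_ideal m ->
     forall (S : comNzRingType) (iota : {rmorphism R -> S}),
       is_localization m iota ->
       in_Ephi (map_mx (fun r => @mconst S t (iota r)) phi)
           (map_mx (@mmap R S iota t) theta)) ->
  in_Ephi (map_mx (@mconst R t) phi) theta.
Proof.
move=> n2 _ alt_phi pf1 det1 theta0 loc.
have unit_phi : exists W, phi *m W = 1%:M.
  have [|W e] := pfaffian_adjoint _ alt_phi; last by exists W; rewrite e pf1.
  by rewrite add1n prednK ?odd_double // double_gt0 ltnW.
have k3 : (2 < (n.*2).-1)%N.
  by rewrite -ltnS prednK ?double_gt0 ?(ltnW n2) // (@leq_double 2).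
have [cd _ _ _] := vaserstein_blocks alt_phi unit_phi.
have theta_inv : theta *m \adj theta = 1%:M by rewrite mul_mx_adj det1.
rewrite -(eq_map_mx _ (@mconst_homE R t)); apply/in_Ephi_map => //.
rewrite !(eq_map_mx _ (@mconst_homE R t)).
apply: (patch_total theta_inv theta0).
(* If 1 were missing, the ideal would lie in some maximal [m], while [patch_local] produces an
   element of it outside [m]. *)
apply: NNPP => J1.
have [m [maxm Jm]] := maximal_ideal_ex (patch_ideal _ _ theta_inv) J1.
have [S [iota locm]] := localization_ex maxm.
have [|s [ms Js]] := patch_local cd theta_inv k3 maxm locm; last by apply/ms/Jm.
have := loc m maxm S iota locm.
rewrite -(eq_map_mx _ (@mmap_homE _ _ iota t)).
have ce p q (M : 'M[R]_(p, q)) : map_mx (mconst_hom S t \o iota) M =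
    map_mx (fun r => mconst t (iota r)) M.
  by apply: eq_map_mx => r /=; rewrite mconst_homE.
by rewrite -!ce => /in_Ephi_map; apply.
Qed.
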